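(* Let $n\ge 1$, $r\ge 0$, and let $f$ be a continuous complex-valued function on $\mathbb C^n$ such that for each $k=0,1,2,\dots$ there is a constant $C_k$ with $$|z|^k e^{\frac14|z|^2}|f(z)|\le C_k\quad\text{for all } z\in\mathbb C^n.$$ Then $f$ is supported in $\{z\in\mathbb C^n:|z|\le r\}$ if and only if $f\times\mu_s(z)=0$ for every $z\in\mathbb C^n$ and every $s>r+|z|$.
   Context: For $s>0$, $\mu_s$ is the normalized (total mass 1) surface measure on $\{w\in\mathbb C^n:|w|=s\}$, and the twisted spherical mean of a continuous function $f$ on $\mathbb C^n$ is $$f\times\mu_s(z)=\int_{|w|=s}f(z-w)\,e^{\frac i2\operatorname{Im}(z\cdot\bar w)}\,d\mu_s(w),\qquad z\in\mathbb C^n,$$ where $z\cdot\bar w=\sum_{j=1}^n z_j\bar w_j$. *)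

(* Defs.v *)
From HB Require Import structures.
From mathcomp Require Import all_boot all_order all_algebra.
From mathcomp Require Import all_classical all_reals all_analysis.
From mathcomp Require Import complex lra ring.

Set Implicit Arguments.
Unset Strict Implicit.
Unset Printing Implicit Defensive.

Import Order.TTheory GRing.Theory Num.Theory.
Import numFieldNormedType.Exports ComplexField.Normc.

Local Open Scope classical_set_scope.
Local Open Scope ring_scope.
Local Open Scope complex_scope.

(* Conventions: C^n is 'rV[R[i]]_n with R[i] the complex numbers over
   R : realType. The library equips 'rV with the sup norm; it gives the right
   topology, but |z| in the sense of the Euclidean (Hermitian) norm is
   [enorm z] below. [normc] is the R-valued modulus. *)

Lemma sigma_finite_product d1 d2 (T1 : measurableType d1)
    (T2 : measurableType d2) (R : realType)
    (m1 : {sigma_finite_measure set T1 -> \bar R})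
    (m2 : {sigma_finite_measure set T2 -> \bar R}) :
  sigma_finite setT (m1 \x m2)%E.
Proof.
have /sigma_finiteP[F [TF ndF Foo]] := sigma_finiteT m1.
have /sigma_finiteP[G [TG ndG Goo]] := sigma_finiteT m2.
exists (fun k => F k `*` G k).
  rewrite -setXTT TF TG predeqE => -[x y]; split=> [[[i _ Fix] [j _ Gjy]]|].
    exists (maxn i j) => //; split.
    - by move: Fix; apply/subsetPset/ndF/leq_maxl.
    - by move: Gjy; apply/subsetPset/ndG/leq_maxr.
  by move=> [k _ []/= ? ?]; split; exists k.
move=> k; have [? ?] := Foo k; have [? ?] := Goo k.
split; first exact: measurableX.
by rewrite product_measure1E// lte_mul_pinfty// ge0_fin_numE.
Qed.

Section tuple_product_measure.
Context d (T : measurableType d) (R : realType).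
Variable m : {sigma_finite_measure set T -> \bar R}.

Definition tuple_cons n (p : T * n.-tuple T) : n.+1.-tuple T :=
  [tuple of p.1 :: p.2].

Lemma measurable_tuple_cons n : measurable_fun setT (@tuple_cons n).
Proof.
exact: (@measurable_cons _ _ (T * n.-tuple T)%type T fst n snd).
Qed.

Definition tuple_uncons n (t : n.+1.-tuple T) : T * n.-tuple T :=
  (thead t, [tuple of behead t]).

Lemma measurable_tuple_uncons n : measurable_fun setT (@tuple_uncons n).
Proof.
apply/measurable_fun_pairP; split.
- exact: measurable_tnth.
- exact: measurable_behead.
Qed.

Lemma tuple_consK n : cancel (@tuple_cons n) (@tuple_uncons n).
Proof.
move=> [x t]; rewrite /tuple_uncons /tuple_cons /=; congr (_, _).
exact/val_inj.
Qed.


Definition consm n (m' : {sigma_finite_measure set (n.-tuple T) -> \bar R}) :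
  set (n.+1.-tuple T) -> \bar R := pushforward (m \x m')%E (@tuple_cons n).

Section instances.
Variables (n : nat) (m' : {sigma_finite_measure set (n.-tuple T) -> \bar R}).

Let consm0 : consm m' set0 = 0%E.
Proof. apply: measure0; exact: measurable_tuple_cons. Qed.

Let consm_ge0 A : (0 <= consm m' A)%E.
Proof. apply: measure_ge0; exact: measurable_tuple_cons. Qed.

Let consm_sigma_additive : semi_sigma_additive (consm m').
Proof. apply: measure_semi_sigma_additive; exact: measurable_tuple_cons. Qed.

HB.instance Definition _ := isMeasure.Build _ _ _ (consm m')
  consm0 consm_ge0 consm_sigma_additive.

Let consm_sigma_finite : sigma_finite setT (consm m').
Proof.
have [F TF Foo] := sigma_finite_product m m'.
exists (fun k => @tuple_uncons n @^-1` (F k)).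
  by rewrite -preimage_bigcup -TF preimage_setT.
move=> k; have [mF Fk] := Foo k; split.
  by rewrite -[X in measurable X]setTI; exact: measurable_tuple_uncons.
rewrite /consm /pushforward -comp_preimage (_ : _ \o _ = id) ?preimage_id//.
by apply/funext => p; exact: tuple_consK.
Qed.

HB.instance Definition _ := Measure_isSigmaFinite.Build _ _ _ (consm m')
  consm_sigma_finite.
End instances.

(* The n-fold product measure m x ... x m. *)
Fixpoint tuple_measure n : {sigma_finite_measure set (n.-tuple T) -> \bar R} :=
  if n is n'.+1 then consm (tuple_measure n') else \d_ [tuple].

Lemma measurable_cube n (I : set T) : measurable I ->
  measurable [set x : n.-tuple T | forall i, I (tnth x i)].
Proof.
move=> mI; rewrite (_ : mkset _ =
    \bigcap_(i in [set: 'I_n]) ((@tnth n T ^~ i) @^-1` I)).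
  apply: fin_bigcap_measurable => // i _; rewrite -[X in measurable X]setTI.
  exact: measurable_tnth.
by apply/seteqP; split=> x /= Ix i => [_|]; exact: Ix.
Qed.

Lemma tuple_measure_cube n (I : set T) : measurable I ->
  tuple_measure n [set x | forall i, I (tnth x i)] = (m I ^+ n)%E.
Proof.
move=> mI; elim: n => [|n IHn].
  by rewrite /= diracE mem_set// => -[].
rewrite expeS -IHn -product_measure1E//; last exact: measurable_cube.
rewrite /consm /pushforward; congr (product_measure1 _ _ _).
apply/seteqP; split=> -[x t] /= => [h|[Ix It] i].
  split; first by have := h ord0.
  by move=> i; have := h (lift ord0 i); rewrite tnthS.
by case: (unliftP ord0 i) => [j ->|-> //]; rewrite tnthS; exact: It.
Qed.

End tuple_product_measure.

(* The library does not put a topology on R[i]; this is the one given by the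
   modulus. *)
HB.instance Definition _ (R : rcfType) := NormedModule.copy R[i] R[i]^o.

Section complex_space.
Variable R : realType.

Lemma continuous_normc : continuous (@normc R).
Proof.
move=> x; apply/(@cvgrPdist_lt _ _ _ _ (nbhs_filter x)) => e e0.
have ec0 : 0 < e%:C by rewrite ltcR.
have := nbhsx_ballx x _ ec0; apply: filterS => y xy.
suff : `| `|x| - `|y| | < e%:C.
  by rewrite -[X in `|X|]/((normc x)%:C - (normc y)%:C) -rmorphB normc_def /=
    expr0n addr0 sqrtr_sqr ltcR.
exact: le_lt_trans (ler_dist_dist _ _) xy.
Qed.

Lemma continuous_real_complex : continuous (real_complex R : R -> R[i]).
Proof.
move=> x; apply/(@cvgrPdist_lt _ _ _ _ (nbhs_filter x)) => e e0.
have [r eE] : exists r, e = r%:C.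
  by exists (complex.Re e); rewrite RRe_real// gtr0_real.
move: e0; rewrite {}eE ltcR => r0; have := nbhsx_ballx x _ r0; apply: filterS => y.
by rewrite -rmorphB normc_def /= expr0n addr0 sqrtr_sqr ltcR.
Qed.

Definition enorm n (z : 'rV[R[i]]_n) : R :=
  Num.sqrt (\sum_j normc (z 0 j) ^+ 2).

Definition borelC n := g_sigma_algebraType (@open 'rV[R[i]]_n).

Definition row_of_coords n (x : (n + n).-tuple R) : borelC n :=
  \row_j (tnth x (lshift n j) +i* tnth x (rshift n j)).

Lemma continuous_enorm n : continuous (@enorm n).
Proof.
move=> z; apply: (@continuous_comp _ _ _
  (fun z : 'rV[R[i]]_n => \sum_j normc (z 0 j) ^+ 2 : R) (@Num.sqrt R));
  last exact: sqrt_continuous.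
rewrite /prop_for /=.
have nc j : normc (y 0 j) @[y --> z] --> normc (z 0 j).
  apply: (@continuous_comp _ _ _ (fun y : 'rV[R[i]]_n => y 0 j) (@normc R)).
    exact: coord_continuous.
  exact: continuous_normc.
elim: (index_enum _) => [|j r IHr].
  have -> : (fun y : 'rV[R[i]]_n => \sum_(j <- [::]) normc (y 0 j) ^+ 2) = cst 0.
    by apply/funext => y; rewrite big_nil.
  exact: cst_continuous.
have -> : (fun y : 'rV[R[i]]_n => \sum_(i <- j :: r) normc (y 0 i) ^+ 2) =
    fun y => normc (y 0 j) * normc (y 0 j) + \sum_(i <- r) normc (y 0 i) ^+ 2.
  by apply/funext => y; rewrite big_cons expr2.
apply: (@cvgD _ _ _ (nbhs z) _ (fun y : 'rV[R[i]]_n =>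
  normc (y 0 j) * normc (y 0 j) : R)) IHr.
by apply: (@cvgM _ _ (nbhs z) _ (fun y : 'rV[R[i]]_n => normc (y 0 j) : R));
  exact: nc.
Qed.

Let box n (p : {ffun 'I_n -> rat * rat} * nat) : set 'rV[R[i]]_n :=
  [set z | forall j,
    `|complex.Re (z 0 j) - ratr (p.1 j).1| < p.2.+1%:R^-1 /\
    `|complex.Im (z 0 j) - ratr (p.1 j).2| < p.2.+1%:R^-1].

Let open_box n (U : set 'rV[R[i]]_n) z : open U -> U z ->
  exists p, box p z /\ box p `<=` U.
Proof.
move=> oU Uz; have /nbhs_ballP[e /= e0 eU] := open_nbhs_nbhs (conj oU Uz).
have [r eE] : exists r, e = r%:C.
  by exists (complex.Re e); rewrite RRe_real// gtr0_real.
move: e0; rewrite /= eE ltcR => r0.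
have r40 : 0 < r / 4 by rewrite divr_gt0.
have [k _ /(_ k (leqnn k)) kr] := near_infty_natSinv_lt (PosNum r40).
rewrite /= in kr.
have kp : 0 < k.+1%:R^-1 :> R by rewrite invr_gt0.
have [q Pq] : {q : R -> rat & forall x, `|x - ratr (q x)| < k.+1%:R^-1}.
  apply: (@boolp.choice _ _ (fun (x : R) (p : rat) => is_true (`|x - ratr p| < k.+1%:R^-1))) => x.
  move: (k.+1%:R^-1) kp {kr} => d d0.
  have [|p] := @rat_in_itvoo R (x - d) (x + d); first by lra.
  rewrite in_itv /= => /andP[p1 p2]; exists p; rewrite ltr_norml.
  by apply/andP; split; lra.
exists ([ffun j => (q (complex.Re (z 0 j)), q (complex.Im (z 0 j)))], k).
split=> [j|w zw]; first by rewrite ffunE /=; split; exact: Pq.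
apply: eU; rewrite eE; split; first by rewrite ltcR.
move=> i j; rewrite !ord1 {i}; have := zw j; rewrite ffunE /= => -[].
have := Pq (complex.Re (z 0 j)); have := Pq (complex.Im (z 0 j)).
move: (ratr _) (ratr _) (k.+1%:R^-1) kr => x y d dr.
rewrite /ball /= normc_def ltcR.
case: (z 0 j) (w 0 j) => [a b] [a' b'] /=; rewrite !ltr_norml.
move=> /andP[? ?] /andP[? ?] /andP[? ?] /andP[? ?].
have a2 : `|a - a'| < d *+ 2 by rewrite ltr_norml; apply/andP; split; lra.
have b2 : `|b - b'| < d *+ 2 by rewrite ltr_norml; apply/andP; split; lra.
apply: (@le_lt_trans _ _ (`|a - a'| + `|b - b'|)); last by lra.
rewrite -[leRHS]ger0_norm ?addr_ge0// -sqrtr_sqr ler_wsqrtr//.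
rewrite [leRHS]sqrrD !real_normK ?num_real// addrAC lerDl.
by rewrite mulrn_wge0// mulr_ge0.
Qed.

Lemma measurable_row_of_coords n : measurable_fun setT (@row_of_coords n).
Proof.
apply: (@measurability _ _ ((n + n).-tuple R : measurableType _)
  (borelC n : measurableType _) _ _ (@open 'rV[R[i]]_n)) => //.
move=> _ [U oU <-]; rewrite setTI.
pose F p := if `[< box p `<=` U >] then @row_of_coords n @^-1` box p else set0.
have -> : @row_of_coords n @^-1` U = \bigcup_p F p.
  apply/seteqP; split=> [x /= /(open_box oU)[p [px pU]]|x [p _]].
    by exists p => //; rewrite /F asboolT.
  by rewrite /F; case: asboolP => // pU /pU.
apply: countable_bigcupT_measurable => // p.
rewrite /F; case: asboolP => // _.
rewrite (_ : _ @^-1` _ = \bigcap_(j in [set: 'I_n])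
  ((fun x : (n + n).-tuple R => tnth x (lshift n j)) @^-1`
     ball (ratr (p.1 j).1 : R) p.2.+1%:R^-1 `&`
   (fun x : (n + n).-tuple R => tnth x (rshift n j)) @^-1`
     ball (ratr (p.1 j).2 : R) p.2.+1%:R^-1)).
  apply: fin_bigcap_measurable => // j _.
  apply: measurableI; rewrite -[X in measurable X]setTI;
    by apply: measurable_tnth => //; rewrite ball_itv; exact: measurable_itv.
apply/seteqP; split=> x /= xp j; have := xp j; rewrite /row_of_coords mxE /ball /=.
  by move=> [? ?] _; split; rewrite distrC.
by move=> /(_ I)[? ?]; split; rewrite distrC.
Qed.

(* Lebesgue measure of C^n = R^(2n), on the Borel sets. *)
Definition lebesgueC n : set (borelC n) -> \bar R :=
  pushforward (tuple_measure (@lebesgue_measure R) (n + n)) (@row_of_coords n).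

Section lebesgueC_instance.
Variable n : nat.

Let lebesgueC0 : @lebesgueC n set0 = 0%E.
Proof. by apply: measure0; exact: measurable_row_of_coords. Qed.

Let lebesgueC_ge0 A : (0 <= @lebesgueC n A)%E.
Proof. by apply: measure_ge0; exact: measurable_row_of_coords. Qed.

Let lebesgueC_sigma_additive : semi_sigma_additive (@lebesgueC n).
Proof.
by apply: measure_semi_sigma_additive; exact: measurable_row_of_coords.
Qed.

HB.instance Definition _ := isMeasure.Build _ _ _ (@lebesgueC n)
  lebesgueC0 lebesgueC_ge0 lebesgueC_sigma_additive.
End lebesgueC_instance.

Section surface_measure.
Variables (n : nat) (s : {posnum R}).

(* The part of the cone with apex 0 over A cut out by the sphere of radius s:
   the points t w with 0 < t <= 1, |w| = s and w in A. *)
Definition sector (A : set (borelC n)) : set (borelC n) :=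
  [set z | 0 < enorm z <= s%:num /\ A ((s%:num / enorm z)%:C *: z)].

Let continuous_radial (z : 'rV[R[i]]_n) : 0 < enorm z ->
  {for z, continuous (fun z : 'rV[R[i]]_n => (s%:num / enorm z)%:C *: z)}.
Proof.
move=> z0.
have h1 : s%:num / enorm y @[y --> z] --> s%:num / enorm z.
  apply: (@cvgM _ _ (nbhs z) _ (fun=> s%:num) (fun y => (enorm y)^-1)).
    exact: cvg_cst.
  by apply: cvgV; [rewrite gt_eqF|exact: continuous_enorm].
have h2 : (s%:num / enorm y)%:C @[y --> z] --> (s%:num / enorm z)%:C.
  by apply: cvg_comp h1 _; exact: continuous_real_complex.
exact: (cvgZ h2 cvg_id).
Qed.

Lemma measurable_sector A : measurable A -> measurable (sector A).
Proof.
pose D : set (borelC n) := [set z | 0 < enorm z <= s%:num].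
have open_gt a : open [set z : 'rV[R[i]]_n | a < enorm z].
  have := open_comp (fun z _ => @continuous_enorm n z) (@open_gt R a).
  exact.
have mgt a : measurable ([set z | a < enorm z] : set (borelC n)).
  exact: sub_sigma_algebra.
have mD : measurable D.
  rewrite (_ : D = [set z | 0 < enorm z] `\` [set z | s%:num < enorm z]).
    exact: measurableD.
  apply/seteqP; split=> z /=.
    by move=> /andP[z0 zs]; split=> //; apply/negP; rewrite -leNgt.
  by move=> [z0 /negP]; rewrite -leNgt => zs; apply/andP.
suff : measurable_fun D
    (fun z => (s%:num / enorm z)%:C *: (z : 'rV[R[i]]_n) : borelC n).
  by move=> mf /(mf mD).
apply: (@measurability _ _ (borelC n : measurableType _)
  (borelC n : measurableType _) _ _ (@open 'rV[R[i]]_n)) => //.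
move=> _ [U oU <-].
pose V : set 'rV[R[i]]_n :=
  [set z | 0 < enorm z /\ U ((s%:num / enorm z)%:C *: z)].
rewrite (_ : _ `&` _ = D `&` V).
  apply: measurableI => //; apply: sub_sigma_algebra.
  rewrite openE => z [z0 Uz]; apply: filterI.
    by apply: open_nbhs_nbhs; split => //; exact: (open_gt 0).
  apply: (continuous_radial z0); exact: open_nbhs_nbhs.
apply/seteqP; split=> z [Dz] /=; first by split=> //; split=> //; case/andP: Dz.
by case.
Qed.

(* Surface measure on the sphere of radius s of R^N, N = n + n, defined as in
   the polar-coordinates construction: a cone over A of height s has volume
   s / N times the area of A. It is carried by [csphere n s]. *)
Definition surface_measure (A : set (borelC n)) : \bar R :=
  (((n + n)%:R / s%:num)%:E * lebesgueC (sector A))%E.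

Let surface_measure0 : surface_measure set0 = 0%E.
Proof.
rewrite /surface_measure (_ : sector set0 = set0) ?measure0 ?mule0//.
by apply/seteqP; split=> z [].
Qed.

Let surface_measure_ge0 A : (0 <= surface_measure A)%E.
Proof. by rewrite mule_ge0// lee_fin divr_ge0. Qed.

Let surface_measure_sigma_additive : semi_sigma_additive surface_measure.
Proof.
move=> F mF tF mUF; rewrite /surface_measure.
have -> : sector (\bigcup_k F k) = \bigcup_k sector (F k).
  apply/seteqP; split=> z; first by move=> [z0 [k _ Fk]]; exists k.
  by move=> [k _ [z0 Fk]]; split=> //; exists k.
rewrite [X in X @ _ --> _](_ : _ = (fun k => ((n + n)%:R / s%:num)%:E *
    \sum_(0 <= i < k) lebesgueC (sector (F i)))%E); last first.
  by apply/funext => k; rewrite ge0_sume_distrr.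
apply: cvgeZl => //; apply: measure_semi_sigma_additive.
- by move=> k; exact: measurable_sector.
- move=> i j _ _ [z [[_ zi] [_ zj]]]; apply: tF => //.
  by exists ((s%:num / enorm z)%:C *: z).
- by apply: bigcup_measurable => k _; exact: measurable_sector.
Qed.

HB.instance Definition _ := isMeasure.Build _ _ _ surface_measure
  surface_measure0 surface_measure_ge0 surface_measure_sigma_additive.

Lemma surface_measure_setT_gt0 : (0 < n)%N -> (0 < surface_measure setT)%E.
Proof.
move=> n0; apply: mule_gt0; first by rewrite lte_fin divr_gt0// ltr0n addn_gt0 n0.
set d : R := s%:num / (n + n)%:R.
have d0 : 0 < d by rewrite divr_gt0// ltr0n addn_gt0 n0.
pose I : set R := `]0, d]%classic.
have mI : measurable I by exact: measurable_itv.
have : (tuple_measure (@lebesgue_measure R) (n + n)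
    [set x | forall i, I (tnth x i)] <=
    lebesgueC (sector setT))%E.
  apply: le_measure; rewrite ?inE.
  - exact: measurable_cube.
  - rewrite -[X in measurable X]setTI; apply: measurable_row_of_coords => //.
    exact: measurable_sector.
  move=> x /= xd; split=> //.
  have xI i : 0 < tnth x i <= d by have := xd i; rewrite /I /= in_itv.
  have row j : normc ((row_of_coords x : 'rV_n) 0 j) ^+ 2 =
      tnth x (lshift n j) ^+ 2 + tnth x (rshift n j) ^+ 2.
    by rewrite mxE /= sqr_sqrtr// addr_ge0 ?sqr_ge0.
  rewrite /enorm; apply/andP; split.
    rewrite sqrtr_gt0 (bigD1 (Ordinal n0))//= row ltr_pwDl//.
      by rewrite ltr_pwDl ?sqr_ge0// exprn_gt0//; case/andP: (xI (lshift n (Ordinal n0))).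
    by apply: sumr_ge0 => j _; rewrite sqr_ge0.
  rewrite -[leRHS]ger0_norm// -sqrtr_sqr ler_wsqrtr//.
  apply: (@le_trans _ _ (\sum_(j < n) (d ^+ 2 *+ 2))).
    apply: ler_sum => j _; rewrite row mulr2n lerD//.
      by have /andP[/ltW ? ?] := xI (lshift n j); rewrite lerXn2r// nnegrE ltW.
    by have /andP[/ltW ? ?] := xI (rshift n j); rewrite lerXn2r// nnegrE ltW.
  rewrite sumr_const card_ord -mulrnA mul2n -addnn -mulr_natr /d exprMn -mulrA.
  rewrite ler_piMr ?sqr_ge0// expr2 -mulrA mulVf ?mulr1 ?invf_le1 ?ler1n ?ltr0n ?pnatr_eq0 -?lt0n ?addn_gt0 ?n0//.
apply: lt_le_trans.
rewrite tuple_measure_cube// (_ : _ I = d%:E); last first.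
  by rewrite [LHS]lebesgue_measure_itv/= lte_fin d0 sube0.
by rewrite -EFin_expe lte_fin exprn_gt0.
Qed.

Lemma surface_measure_setT_lty : (surface_measure setT < +oo)%E.
Proof.
rewrite /surface_measure lte_mul_pinfty ?lee_fin ?divr_ge0//.
pose I : set R := `[- s%:num, s%:num]%classic.
have mI : measurable I by exact: measurable_itv.
have : (lebesgueC (sector setT) <= tuple_measure (@lebesgue_measure R) (n + n)
    [set x | forall i, I (tnth x i)])%E.
  rewrite /lebesgueC /pushforward; apply: le_measure; rewrite ?inE.
  - rewrite -[X in measurable X]setTI; apply: measurable_row_of_coords => //.
    exact: measurable_sector.
  - by apply: measurable_cube.
  move=> x /= [/andP[_ xs] _] i; rewrite /I /= in_itv /= -ler_norml.
  apply: le_trans xs; rewrite -sqrtr_sqr /enorm ler_wsqrtr//.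
  have row j : normc ((row_of_coords x : 'rV_n) 0 j) ^+ 2 =
      tnth x (lshift n j) ^+ 2 + tnth x (rshift n j) ^+ 2.
    by rewrite mxE /= sqr_sqrtr// addr_ge0 ?sqr_ge0.
  have [j iE] : exists j : 'I_n, i = lshift n j \/ i = rshift n j.
    by case: (splitP i) => j ij; exists j; [left|right]; exact/val_inj.
  rewrite (bigD1 j)//= row ler_wpDr ?sumr_ge0// => [k _|]; first by rewrite sqr_ge0.
  by case: iE => ->; rewrite ?lerDl ?lerDr sqr_ge0.
move=> /le_lt_trans; apply.
rewrite tuple_measure_cube// (_ : _ I = (s%:num - - s%:num)%:E); last first.
  by rewrite [LHS]lebesgue_measure_itv/= lte_fin gtrN.
by rewrite -EFin_expe ltry.
Qed.

(* Total mass 1. The Dirac argument of [mnormalize] is a default for total mass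
   0 or +oo, which does not occur for 0 < n, see [sphere_measureE]. *)
Definition sphere_measure : probability (borelC n) R :=
  mnormalize surface_measure (\d_ (0 : borelC n)).

Lemma sphere_measureE A : (0 < n)%N ->
  sphere_measure A = (surface_measure A * (fine (surface_measure setT))^-1%:E)%E.
Proof.
move=> n0; rewrite /sphere_measure /= /mnormalize.
by rewrite gt_eqF ?surface_measure_setT_gt0// lt_eqF ?surface_measure_setT_lty.
Qed.
End surface_measure.
Arguments sphere_measure : clear implicits.

Definition csphere n (s : R) : set (borelC n) := [set w | enorm w = s].
Arguments csphere : clear implicits.

(* Integral of a complex-valued function. *)
Definition cintegral d (T : measurableType d) (mu : {measure set T -> \bar R})
    (D : set T) (g : T -> R[i]) : R[i] :=
  (\int[mu]_(x in D) complex.Re (g x)) +i* (\int[mu]_(x in D) complex.Im (g x)).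

(* e^(i t) *)
Definition expi (t : R) : R[i] := cos t +i* sin t.

Definition twisted_mean n (f : 'rV[R[i]]_n -> R[i]) (s : {posnum R})
    (z : 'rV[R[i]]_n) : R[i] :=
  cintegral (sphere_measure n s) (csphere n s%:num)
    (fun w => f (z - w) * expi (complex.Im (\sum_j z 0 j * (w 0 j)^*) / 2)).

Definition supp n (f : 'rV[R[i]]_n -> R[i]) : set 'rV[R[i]]_n :=
  closure [set z | f z != 0].

End complex_space.

(* Main.v *)
(* With [h u := f u * exp (- |u|^2 / 4)], the vanishing of the twisted means
   says that for every [A > (r + |z|)^2] the integral over [C^n] of
   [K_N (|u - z|^2 - A) exp (conj z . u / 2) h u] is 0, where
   [K_N x := (max x 0 / 2)^N / N!] satisfies [K_(N+1)' = K_N / 2].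
   Differentiating this in [z] along [v] and along [i v] and combining, one gets
   that the integrals for [(conj v . u) h] do not depend on [N >= 1] and those for
   [(v . conj u) h] vanish. So up to finite differences in the index [N] the
   property passes from [h] to [p h] for every polynomial [p] in [u] and [conj u].
   At [z = 0] the Gaussian decay of [h] makes the integrals tend to 0 as
   [N -> oo], hence a sequence with a vanishing [b]-th difference is 0:
   [p h] is orthogonal to [K_1 (|u|^2 - A)] for all [p] and all [A > r^2].
   Second differences of [K_1] in [A] are hat functions supported in a thin
   spherical shell, and there the powers of a polynomial peaking at [u0] give
   [h u0 = 0]. *)
Require Import Defs.
From HB Require Import structures.
From mathcomp Require Import all_boot all_order all_algebra.
From mathcomp Require Import all_classical all_reals all_analysis.
From mathcomp Require Import measurable_realfun complex lra ring.

Set Implicit Arguments.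
Unset Strict Implicit.
Unset Printing Implicit Defensive.

Import Order.TTheory GRing.Theory Num.Theory.
Import numFieldNormedType.Exports ComplexField.Normc.

Local Open Scope classical_set_scope.
Local Open Scope ring_scope.

(** * Affine substitutions in integrals over R, R^m and C^n *)

Section affine_change_of_variables.
Context {R : realType}.
Local Notation leb := (@lebesgue_measure R).

(** The factor 1/2 in [K_N] does two jobs. Differentiating [K_(N+1) (|u - z|^2 - A)] in [z] along
    [v] gives exactly [- K_N Re (conj v . (u - z))], so integrals of index [N] and [N + 1] agree
    without a geometric factor. And [K_N (|u|^2 - A) <= exp (|u|^2 / 2)] uniformly in [N], which is
    just the growth that [h] absorbs: by hypothesis [exp (|u|^2 / 2) h] decays faster than any
    power. For [z <> 0] the analogous bound has the extra factor [exp (- Re (conj z . u) / 2)]; this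
    is why the limit in [N] is taken at the origin, after the freedom in [z] has been spent on
    producing polynomial factors. The two kinds of factor behave differently because
    [exp (conj z . u / 2)] is antiholomorphic in [z]. Differentiation in [z] is possible because
    [A > (r + |z|)^2] is an open condition. Spherical means themselves are never differentiated:
    weighted by [K_N] they become Lebesgue integrals, which requires polar coordinates for a surface
    measure defined by cones. *)

Lemma measurable_affine (c a : R) : measurable_fun setT (fun x : R => c * x + a).
Proof. by apply: measurable_funD => //; exact: measurable_funM. Qed.

(** Uniqueness of Lebesgue measure: [|c|] times the image of [leb] under the map agrees with [leb]
    on the intervals []x, y]]. For [c < 0] the preimage is closed on the left instead, with the same
    length. *)
Lemma lebesgue_measure_affine (c a : R) (A : set R) : c != 0 -> measurable A ->
  leb ((fun x => c * x + a) @^-1` A) = (`|c|^-1%:E * leb A)%E.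
Proof.
move=> c0 mA; have nc0 : 0 < `|c| by rewrite normr_gt0.
have c_ge0 : 0 <= `|c| by [].
pose phi : measurableTypeR R -> measurableTypeR R := fun x : R => c * x + a.
have mphi : measurable_fun setT phi by exact: measurable_affine.
pose mu : {measure set (measurableTypeR R) -> \bar R} :=
  mscale (NngNum c_ge0) (pushforward leb phi).
have muE B : mu mphi B = (`|c|%:E * leb (phi @^-1` B))%E by [].
suff -> : leb A = mu mphi A by rewrite muE muleA -EFinM mulVf ?mul1e// gt_eqF.
apply: lebesgue_measure_unique => // X /ocitvP[->|[[x y] /= xy ->]].
  by rewrite !measure0.
rewrite muE [LHS]lebesgue_measure_itv /= lte_fin xy.
have [c_gt0|c_lt0|/eqP] := ltgtP c 0; last by rewrite (negbTE c0).
- rewrite (_ : _ @^-1` _ = `[(y - a) / c, (x - a) / c[%classic).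
    rewrite [X in (_ * X)%E]lebesgue_measure_itv /= lte_fin ltr_nM2r ?invr_lt0//.
    rewrite ltrD2r xy -!EFinB -EFinM ltr0_norm//.
    by congr EFin; field.
  apply/seteqP; split=> t /=; rewrite !in_itv /= ler_ndivrMr// ltr_ndivlMr//;
    by rewrite /phi => /andP[h1 h2]; apply/andP; split; lra.
- rewrite (_ : _ @^-1` _ = `](x - a) / c, (y - a) / c]%classic).
    rewrite [X in (_ * X)%E]lebesgue_measure_itv /= lte_fin ltr_pM2r ?invr_gt0//.
    rewrite ltrD2r xy -!EFinB -EFinM gtr0_norm//.
    by congr EFin; field.
  apply/seteqP; split=> t /=; rewrite !in_itv /= ler_pdivlMr// ltr_pdivrMr//;
    by rewrite /phi => /andP[h1 h2]; apply/andP; split; lra.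
Qed.

Lemma ge0_integral_affine (c a : R) (f : R -> \bar R) : c != 0 ->
  measurable_fun setT f -> (forall x, 0 <= f x)%E ->
  (\int[leb]_x f (c * x + a)%R = `|c|^-1%:E * \int[leb]_x f x)%E.
Proof.
move=> c0 mf f0; have c_ge0 : 0 <= `|c|^-1 by rewrite invr_ge0.
pose phi : measurableTypeR R -> measurableTypeR R := fun x : R => c * x + a.
have mphi : measurable_fun setT phi by exact: measurable_affine.
transitivity (\int[leb]_(x in phi @^-1` setT) (f \o phi) x)%E => //.
rewrite -ge0_integral_pushforward//.
rewrite -[X in (X%:E * _)%E]/((NngNum c_ge0)%:num) -ge0_integral_mscale//.
by apply: eq_measure_integral => A mA _; exact: lebesgue_measure_affine.
Qed.

(** Tonelli for the recursive [tuple_measure]; it is the induction step of every integral over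
    tuples. *)
Lemma ge0_integral_tuple d (T : measurableType d)
    (m : {sigma_finite_measure set T -> \bar R}) n (f : n.+1.-tuple T -> \bar R) :
  measurable_fun setT f -> (forall x, 0 <= f x)%E ->
  (\int[tuple_measure m n.+1]_t f t =
   \int[m]_x \int[tuple_measure m n]_t f (tuple_cons (x, t)))%E.
Proof.
move=> mf f0; rewrite /= /consm ge0_integral_pushforward//; last first.
  exact: measurable_tuple_cons.
rewrite preimage_setT (fubini_tonelli1 (f \o @tuple_cons _ T n))//=.
exact: (measurableT_comp mf (@measurable_tuple_cons _ _ n)).
Qed.

Definition tuple_affine n (c : R) (a : 'I_n -> R) (t : n.-tuple R) : n.-tuple R :=
  [tuple c * tnth t i + a i | i < n].

Lemma measurable_tuple_affine n c (a : 'I_n -> R) :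
  measurable_fun setT (tuple_affine c a).
Proof.
apply/measurable_fun_tnthP => i.
rewrite (_ : _ \o _ = fun t => c * tnth t i + a i).
  by apply: (measurableT_comp (measurable_affine c (a i)));
    exact: measurable_tnth.
by apply/funext => t /=; rewrite tnth_mktuple.
Qed.

Lemma tuple_affine_cons n c (a : 'I_n.+1 -> R) x (t : n.-tuple R) :
  tuple_affine c a (tuple_cons (x, t)) =
  tuple_cons (c * x + a ord0, tuple_affine c (a \o lift ord0) t).
Proof.
apply: eq_from_tnth => i; rewrite tnth_mktuple.
by case: (unliftP ord0 i) => [j ->|->]; rewrite ?tnthS ?tnth0 ?tnth_mktuple.
Qed.

Lemma ge0_integral_tuple_affine n (c : R) (a : 'I_n -> R)
    (f : n.-tuple R -> \bar R) : c != 0 ->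
  measurable_fun setT f -> (forall x, 0 <= f x)%E ->
  (\int[tuple_measure leb n]_t f (tuple_affine c a t) =
   (`|c|^-1 ^+ n)%:E * \int[tuple_measure leb n]_t f t)%E.
Proof.
move=> c0; elim: n a f => [|n IHn] a f mf f0.
  rewrite expr0 mul1e; apply: eq_integral => t _; congr f.
  by rewrite (tuple0 t) (tuple0 (tuple_affine _ _ _)).
have mfc (g : n.+1.-tuple R -> \bar R) x : measurable_fun setT g ->
    measurable_fun setT (fun t => g (tuple_cons (x, t))).
  move=> mg; apply: measurableT_comp => //.
  apply: (measurableT_comp (@measurable_tuple_cons _ _ n)).
  exact: measurable_pair1.
rewrite !ge0_integral_tuple//; last first.
  by apply: measurableT_comp => //; exact: measurable_tuple_affine.
under eq_integral do under eq_integral do rewrite tuple_affine_cons.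
under eq_integral => x _.
  rewrite (IHn _ (fun t => f (tuple_cons (c * x + a ord0, t))))//; last exact: mfc.
  over.
pose F : measurableTypeR R -> \bar R := fun y =>
  (\int[tuple_measure leb n]_t f (tuple_cons (y, t)))%E.
have mF : measurable_fun setT F.
  apply: (@measurable_fun_fubini_tonelli_F _ _ (measurableTypeR R) _ R
    (tuple_measure leb n) (f \o @tuple_cons _ (measurableTypeR R) n)) => //=.
  exact: (measurableT_comp mf (@measurable_tuple_cons _ _ n)).
have F0 y : (0 <= F y)%E by exact: integral_ge0.
rewrite -[RHS]/(_ * \int[leb]_x F x)%E.
rewrite -[LHS]/(\int[leb]_x ((`|c|^-1 ^+ n)%:E * F (c * x + a ord0)%R))%E.
have mFc : measurable_fun setT (fun x : measurableTypeR R => F (c * x + a ord0)).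
  exact: (measurableT_comp mF (measurable_affine c (a ord0))).
rewrite (@ge0_integralZl _ _ _ leb setT measurableT _ mFc); last 2 first.
- by move=> x _; exact: F0.
- by rewrite lee_fin exprn_ge0// invr_ge0.
by rewrite (@ge0_integral_affine c (a ord0) F)// exprSr EFinM muleA.
Qed.

Local Open Scope complex_scope.

Lemma ge0_integral_lebesgueC n (f : borelC R n -> \bar R) :
  measurable_fun setT f -> (forall x, 0 <= f x)%E ->
  (\int[@lebesgueC R n]_z f z =
   \int[tuple_measure leb (n + n)]_t f (row_of_coords t))%E.
Proof.
by move=> mf f0; rewrite ge0_integral_pushforward//;
  exact: measurable_row_of_coords.
Qed.

Definition coords_row n (a : 'rV[R[i]]_n) (i : 'I_(n + n)) : R :=
  match fintype.split i with inl j => complex.Re (a 0 j) | inr j => complex.Im (a 0 j) end.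

Lemma row_of_coords_affine n (c : R) (a : 'rV[R[i]]_n) (t : (n + n).-tuple R) :
  row_of_coords (tuple_affine c (coords_row a) t) =
  c%:C *: (row_of_coords t : 'rV[R[i]]_n) + a :> 'rV[R[i]]_n.
Proof.
apply/rowP => j; rewrite !mxE !tnth_mktuple /coords_row.
rewrite -[lshift n j]/(unsplit (inl j)) -[rshift n j]/(unsplit (inr j)) !unsplitK.
by case: (a 0 j) => x y; apply/eqP; rewrite eq_complex /=;
  apply/andP; split; apply/eqP; ring.
Qed.

Lemma ge0_integral_lebesgueC_affine n (c : R) (a : 'rV[R[i]]_n)
    (f : borelC R n -> \bar R) : c != 0 ->
  measurable_fun setT f -> (forall x, 0 <= f x)%E ->
  (\int[@lebesgueC R n]_z f (c%:C *: (z : 'rV[R[i]]_n) + a)%R =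
   (`|c|^-1 ^+ (n + n))%:E * \int[@lebesgueC R n]_z f z)%E.
Proof.
move=> c0 mf f0.
have maff : measurable_fun setT (fun z : borelC R n =>
    c%:C *: (z : 'rV[R[i]]_n) + a : borelC R n).
  apply: (@measurability _ _ (borelC R n : measurableType _)
    (borelC R n : measurableType _) _ _ (@open 'rV[R[i]]_n)) => //.
  move=> _ [U oU <-]; rewrite setTI; apply: sub_sigma_algebra.
  apply: (@open_comp _ _ (fun z : 'rV[R[i]]_n => c%:C *: z + a)) => // z _.
  apply: (@cvgD _ _ _ (nbhs z)); last exact: cvg_cst.
  by apply: (@cvgZ _ _ _ (nbhs z)); [exact: cvg_cst|exact: cvg_id].
rewrite !ge0_integral_lebesgueC//; last exact: (measurableT_comp mf maff).
under eq_integral do rewrite -row_of_coords_affine.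
rewrite (@ge0_integral_tuple_affine _ c (coords_row a) (f \o @row_of_coords R n))//=.
exact: (measurableT_comp mf (@measurable_row_of_coords R n)).
Qed.

End affine_change_of_variables.

(** * Measurable maps into C^n, and sigma-finiteness of its Lebesgue measure *)

Section borelC_measurability.
Context {R : realType}.
Local Open Scope complex_scope.
Local Notation leb := (@lebesgue_measure R).

Lemma continuous_Re : continuous (@complex.Re R : R[i] -> R).
Proof.
move=> x; apply/(@cvgrPdist_lt _ _ _ _ (nbhs_filter x)) => e e0.
have ec0 : 0 < e%:C by rewrite ltcR.
have := nbhsx_ballx x _ ec0; apply: filterS => y xy.
rewrite -raddfB -ltcR; apply: le_lt_trans xy.
by case: (x - y) => a b; exact: normc_ge_Re.
Qed.

Lemma continuous_Im : continuous (@complex.Im R : R[i] -> R).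
Proof.
move=> x; apply/(@cvgrPdist_lt _ _ _ _ (nbhs_filter x)) => e e0.
have ec0 : 0 < e%:C by rewrite ltcR.
have := nbhsx_ballx x _ ec0; apply: filterS => y xy.
rewrite -raddfB -ltcR; apply: le_lt_trans xy.
case: (x - y) => a b; rewrite normc_def lecR /= -sqrtr_sqr ler_wsqrtr//.
by rewrite lerDr sqr_ge0.
Qed.

Lemma continuous_measurable_borelC n (g : 'rV[R[i]]_n -> R) : continuous g ->
  measurable_fun setT (g : borelC R n -> R).
Proof.
move=> cg; apply: (measurability _ (RGenOInfty.measurableE R)) => //.
move=> _ [_ [a ->] <-]; rewrite setTI; apply: sub_sigma_algebra.
by apply: open_comp => [z _|]; [exact: cg|exact: interval_open].
Qed.

Lemma measurable_Re_coord n j :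
  measurable_fun setT (fun z : borelC R n => complex.Re ((z : 'rV[R[i]]_n) 0 j)).
Proof.
apply: continuous_measurable_borelC => z.
apply: (@continuous_comp _ _ _ (fun y : 'rV[R[i]]_n => y 0 j) (@complex.Re R)).
  exact: coord_continuous.
exact: continuous_Re.
Qed.

Lemma measurable_Im_coord n j :
  measurable_fun setT (fun z : borelC R n => complex.Im ((z : 'rV[R[i]]_n) 0 j)).
Proof.
apply: continuous_measurable_borelC => z.
apply: (@continuous_comp _ _ _ (fun y : 'rV[R[i]]_n => y 0 j) (@complex.Im R)).
  exact: coord_continuous.
exact: continuous_Im.
Qed.

Lemma measurable_enorm n : measurable_fun setT (@enorm R n : borelC R n -> R).
Proof. by apply: continuous_measurable_borelC; exact: continuous_enorm. Qed.

(** The sigma-algebra is generated by the open sets, not by the coordinates, so [g] is factored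
    through its real coordinates and [row_of_coords]. *)
Lemma measurable_borelCP d (T : measurableType d) n (g : T -> borelC R n) :
  (forall j, measurable_fun setT (fun t => complex.Re ((g t : 'rV[R[i]]_n) 0 j))) ->
  (forall j, measurable_fun setT (fun t => complex.Im ((g t : 'rV[R[i]]_n) 0 j))) ->
  measurable_fun setT g.
Proof.
move=> mRe mIm.
pose t x : (n + n).-tuple R := [tuple coords_row (g x : 'rV[R[i]]_n) i | i < n + n].
have -> : g = @row_of_coords R n \o t.
  apply/funext => x /=; apply/rowP => j; rewrite !mxE !tnth_mktuple /coords_row.
  rewrite -[lshift n j]/(unsplit (inl j)) -[rshift n j]/(unsplit (inr j)).
  by rewrite !unsplitK; case: ((g x : 'rV__) 0 j).
apply: measurableT_comp; first exact: measurable_row_of_coords.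
apply/measurable_fun_tnthP => i.
rewrite (_ : _ \o _ = fun x => coords_row (g x : 'rV[R[i]]_n) i); last first.
  by apply/funext => x /=; rewrite tnth_mktuple.
by rewrite /coords_row; case: fintype.split => j.
Qed.

(** Continuity fails at 0, where the value is 0 by convention, so that point is split off. *)
Lemma measurable_invr : measurable_fun setT (fun x : R => x^-1).
Proof.
have mI : measurable_fun [set x : R | x != 0] (fun x : R => x^-1).
  apply: open_continuous_measurable_fun; first exact: open_neq.
  by move=> x; rewrite inE /= => x0; exact: inv_continuous.
have -> : [set: R] = [set x : R | x != 0] `|` [set 0].
  by apply/seteqP; split=> x //= _; case: (eqVneq x 0); [right|left].
apply/measurable_funU => //; first exact: open_measurable (@open_neq _ _).
split=> //; exact: measurable_fun_set1.
Qed.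

Lemma measurable_scale_borelC d (T : measurableType d) n (c : T -> R)
    (g : T -> borelC R n) : measurable_fun setT c -> measurable_fun setT g ->
  measurable_fun setT (fun t => (c t)%:C *: (g t : 'rV[R[i]]_n) : borelC R n).
Proof.
move=> mc mg; apply: measurable_borelCP => j.
- rewrite (_ : (fun _ => _) = fun t => c t * complex.Re ((g t : 'rV__) 0 j)).
    apply: measurable_funM => //.
    exact: (measurableT_comp (@measurable_Re_coord n j) mg).
  apply/funext => t; rewrite mxE; case: ((g t : 'rV__) 0 j) => a b /=.
  by rewrite mul0r subr0.
- rewrite (_ : (fun _ => _) = fun t => c t * complex.Im ((g t : 'rV__) 0 j)).
    apply: measurable_funM => //.
    exact: (measurableT_comp (@measurable_Im_coord n j) mg).
  apply/funext => t; rewrite mxE; case: ((g t : 'rV__) 0 j) => a b /=.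
  by rewrite mul0r addr0.
Qed.

Lemma enorm_ge0 n (z : 'rV[R[i]]_n) : 0 <= enorm z.
Proof. exact: sqrtr_ge0. Qed.

Lemma enorm_sqr n (z : 'rV[R[i]]_n) : enorm z ^+ 2 =
  \sum_j (complex.Re (z 0 j) ^+ 2 + complex.Im (z 0 j) ^+ 2).
Proof.
rewrite sqr_sqrtr; last by apply: sumr_ge0 => j _; rewrite sqr_ge0.
apply: eq_bigr => j _; case: (z 0 j) => a b /=.
by rewrite sqr_sqrtr// addr_ge0 ?sqr_ge0.
Qed.

Lemma enormZ n (c : R) (z : 'rV[R[i]]_n) : enorm (c%:C *: z) = `|c| * enorm z.
Proof.
apply/eqP; rewrite -(@eqrXn2 _ 2)// ?mulr_ge0 ?enorm_ge0// exprMn !enorm_sqr.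
rewrite real_normK ?num_real// mulr_sumr; apply/eqP; apply: eq_bigr => j _.
by rewrite mxE; case: (z 0 j) => a b /=; ring.
Qed.

Lemma lebesgueC_sigma_finite n : sigma_finite setT (@lebesgueC R n).
Proof.
exists (fun k : nat => [set z : borelC R n | enorm (z : 'rV[R[i]]_n) <= k%:R]).
  apply/seteqP; split=> z //= _; exists (Num.trunc (enorm (z : 'rV__))).+1 => //=.
  by apply/ltW; exact: truncnS_gt.
move=> k; have mB : measurable [set z : borelC R n | enorm (z : 'rV[R[i]]_n) <= k%:R].
  rewrite (_ : mkset _ = (@enorm R n : borelC R n -> R) @^-1` `]-oo, k%:R]%classic).
    by rewrite -[X in measurable X]setTI; exact: measurable_enorm.
  by apply/seteqP; split=> z /=; rewrite in_itv.
split=> //; pose I : set R := `[- k.+1%:R, k.+1%:R]%classic.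
have mI : measurable I by exact: measurable_itv.
have : (@lebesgueC R n [set z : borelC R n | enorm (z : 'rV[R[i]]_n) <= k%:R]%R <=
    tuple_measure leb (n + n) [set x | forall i, I (tnth x i)])%E.
  rewrite /lebesgueC /pushforward; apply: le_measure; rewrite ?inE.
  - by rewrite -[X in measurable X]setTI; exact: measurable_row_of_coords.
  - exact: measurable_cube.
  move=> x /= xs i; rewrite /I /= in_itv /= -ler_norml.
  apply: (@le_trans _ _ k%:R); last by rewrite ler_nat.
  apply: le_trans xs; rewrite -(@ler_pXn2r _ 2)// ?nnegrE ?enorm_ge0// enorm_sqr.
  rewrite real_normK ?num_real//.
  have [j iE] : exists j : 'I_n, i = lshift n j \/ i = rshift n j.
    by case: (fintype.splitP i) => j ij; exists j; [left|right]; exact/val_inj.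
  rewrite (bigD1 j)//= mxE /= ler_wpDr ?sumr_ge0// => [l _|].
    by rewrite addr_ge0 ?sqr_ge0.
  by case: iE => ->; rewrite ?lerDl ?lerDr sqr_ge0.
move=> /le_lt_trans; apply; rewrite tuple_measure_cube//.
rewrite (_ : _ I = (k.+1%:R - - k.+1%:R)%:E); last first.
  by rewrite [LHS]lebesgue_measure_itv /= lte_fin gtrN.
by rewrite -EFin_expe ltry.
Qed.

HB.instance Definition _ n := Measure_isSigmaFinite.Build _ _ _ (@lebesgueC R n)
  (@lebesgueC_sigma_finite n).

End borelC_measurability.

(** * Polar coordinates for the cone construction *)

Section polar_coordinates.
Context {R : realType}.
Local Open Scope complex_scope.
Local Notation leb := (@lebesgue_measure R).

Lemma ge0_integral_dilation (c : R) (f : measurableTypeR R -> \bar R) : 0 < c ->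
  measurable_fun setT f -> (forall x, 0 <= f x)%E ->
  (\int[leb]_x f x = \int[leb]_x (c%:E * f (c * x)%R))%E.
Proof.
move=> c0 mf f0.
have mfc : measurable_fun setT (fun x : measurableTypeR R => f (c * x)).
  apply: (measurableT_comp mf (g := fun x : measurableTypeR R =>
    c * x : measurableTypeR R)).
  by apply: measurable_funM.
rewrite (@ge0_integralZl _ _ _ leb setT measurableT _ mfc)//; last first.
  by rewrite lee_fin ltW.
under [in RHS]eq_integral do rewrite -[X in f X]addr0.
rewrite (ge0_integral_affine 0 (lt0r_neq0 c0) mf f0) muleA -EFinM ger0_norm ?ltW//.
by rewrite divff ?lt0r_neq0// mul1e.
Qed.

Lemma ge0_integral_lebesgueC_dilation n (c : R) (f : borelC R n -> \bar R) :
  0 < c -> measurable_fun setT f -> (forall x, 0 <= f x)%E ->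
  (\int[@lebesgueC R n]_z f z =
   \int[@lebesgueC R n]_z ((c ^+ (n + n))%:E * f (c%:C *: (z : 'rV[R[i]]_n))%R))%E.
Proof.
move=> c0 mf f0.
have mfc : measurable_fun setT (fun z : borelC R n =>
    f (c%:C *: (z : 'rV[R[i]]_n))%R).
  by apply: (measurableT_comp mf); exact: measurable_scale_borelC.
rewrite (@ge0_integralZl _ _ _ (@lebesgueC R n) setT measurableT _ mfc)//; last first.
  by rewrite lee_fin exprn_ge0// ltW.
under [in RHS]eq_integral do rewrite -[X in f X]addr0.
rewrite (ge0_integral_lebesgueC_affine 0 (lt0r_neq0 c0) mf f0) muleA -EFinM.
by rewrite ger0_norm ?ltW// -exprMn divff ?lt0r_neq0// expr1n mul1e.
Qed.

(** Only a positive finite constant is wanted: on [x >= 1] the integrand is at most [2 / (1 + x^2)],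
    and on [[1, 2]] it is at least [2^-(N+1)]. *)
Lemma power_tail_integral (N : nat) : (0 < N)%N ->
  exists2 c : R, 0 < c &
    (\int[leb]_x (if 1 <= x then x^-1 ^+ N.+1 else 0)%:E = c%:E)%E.
Proof.
move=> N0; set f := fun x : R => if 1 <= x then x^-1 ^+ N.+1 else 0.
have f0 x : 0 <= f x.
  by rewrite /f; case: ifP => // x1; rewrite exprn_ge0// invr_ge0; lra.
have mf : measurable_fun setT (EFin \o f : measurableTypeR R -> \bar R).
  apply/measurable_EFinP; apply: measurable_fun_ifT => //.
  - exact: measurable_fun_ler.
  - by apply: measurable_funX; exact: measurable_invr.
have lt_oo : (\int[leb]_x (f x)%:E < +oo)%E.
  have mg : measurable_fun setT (fun x : R => (oneDsqr x)^-1).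
    by apply: continuous_measurable_fun; exact: continuous_oneDsqrV.
  apply: (@le_lt_trans _ _ (\int[leb]_(x in `[0%R, +oo[)
      (2%:E * (oneDsqr x)^-1%:E))%E); last first.
    rewrite ge0_integralZl//.
    - by rewrite integral0y_oneDsqr -EFinM ltry.
    - by apply/measurable_EFinP; exact: measurable_funTS.
  rewrite [leRHS]integral_mkcond; apply: ge0_le_integral => //.
  - by move=> x _; rewrite lee_fin.
  - rewrite -(measurable_restrictT _ _)//.
    by apply/measurable_EFinP; apply: measurable_funM => //; exact: measurable_funTS.
  move=> x _; rewrite patchE /f; case: ifPn => x1; last first.
    by case: ifPn => _ //; rewrite -EFinM lee_fin mulr_ge0// invr_ge0.
  rewrite mem_set; last by rewrite /= in_itv /= andbT; lra.
  rewrite -EFinM lee_fin exprVn -[X in X * _]invrK -invfM lef_pV2 ?posrE.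
  - rewrite /oneDsqr; apply: (@le_trans _ _ (x ^+ 2)).
      suff : 1 <= x ^+ 2 by move=> ?; lra.
      by rewrite expr_ge1//; lra.
    by apply: ler_weXn2l => //.
  - by rewrite exprn_gt0//; lra.
  - by rewrite mulr_gt0 ?invr_gt0//; rewrite /oneDsqr; have := sqr_ge0 x; lra.
have gt0 : (0 < \int[leb]_x (f x)%:E)%E.
  have d0 : 0 < 2^-1 ^+ N.+1 :> R by rewrite exprn_gt0// invr_gt0.
  apply: (@lt_le_trans _ _ (\int[leb]_(x in `[1%R, 2%R]) (2^-1 ^+ N.+1)%:E)%E).
    rewrite integral_cst//= lebesgue_measure_itv /= lte_fin ltr1n -EFinB -EFinM.
    by rewrite lte_fin mulr_gt0//; lra.
  apply: (@le_trans _ _ (\int[leb]_(x in `[1%R, 2%R]) (f x)%:E)%E).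
    apply: ge0_le_integral => //.
    - exact: measurable_funTS.
    - move=> x /=; rewrite in_itv /= => /andP[x1 x2]; rewrite lee_fin /f x1.
      rewrite lerXn2r// ?nnegrE ?invr_ge0//; first by lra.
      by rewrite lef_pV2// posrE; lra.
  by apply: ge0_subset_integral => // x _; rewrite lee_fin.
exists (fine (\int[leb]_x (f x)%:E)).
  by rewrite fine_gt0// gt0 lt_oo.
by rewrite fineK// ge0_fin_numE// ltW.
Qed.

Lemma measurable_ennorm_snd n :
  measurable_fun setT (fun p : measurableTypeR R * borelC R n =>
    enorm (p.2 : 'rV[R[i]]_n)).
Proof. exact: (measurableT_comp (@measurable_enorm R n) measurable_snd). Qed.

(** The [sector] over the whole unit sphere; without 0 the direction [y / |y|] makes sense. *)
Definition unit_shell n : set (borelC R n) :=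
  [set y | 0 < enorm (y : 'rV[R[i]]_n) <= 1].

Lemma measurable_unit_shell n : measurable (@unit_shell n).
Proof.
rewrite (_ : @unit_shell n = (@enorm R n : borelC R n -> R) @^-1` `]0, 1]%classic).
  by rewrite -[X in measurable X]setTI; exact: measurable_enorm.
by apply/seteqP; split=> z /=; rewrite in_itv.
Qed.

(** Up to a factor independent of [G], the mean over the sphere of radius [s]: the values there are
    extended along rays and integrated over the unit ball. A single domain for all [s] makes Tonelli
    applicable. *)
Definition radial_mean n (G : borelC R n -> \bar R) (s : R) : \bar R :=
  (\int[@lebesgueC R n]_(y in @unit_shell n)
     G ((s / enorm (y : 'rV[R[i]]_n))%:C *: (y : 'rV[R[i]]_n))%R)%E.

(* With [s = l |y|] and then [x = l y] the radial variable [l] only occurs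
   through a power of [l] integrated over [l >= |x|]. *)
Lemma polar_integral n : (0 < n)%N -> exists2 c : R, 0 < c &
  forall G : borelC R n -> \bar R, measurable_fun setT G ->
  (forall x, 0 <= G x)%E ->
  (\int[leb]_s ((if (0 < s)%R then s ^+ (n + n).-1 else 0)%R%:E * radial_mean G s) =
   c%:E * \int[@lebesgueC R n]_x
     (if (0 < enorm (x : 'rV[R[i]]_n))%R then G x else 0))%E.
Proof.
move=> n0; set N := (n + n)%N; have N0 : (0 < N)%N by rewrite addn_gt0 n0.
have [c c0 cE] := power_tail_integral N0; exists c => // G mG G0.
pose e (y : borelC R n) : R := enorm (y : 'rV[R[i]]_n).
(* [w] is the product cut off to 0 outside the domain [b], so that all integrals run over the whole
   space. *)
pose w (b : bool) (x : R) (y : \bar R) := if b then (x%:E * y)%E else 0%E.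
have w0 (b : bool) x y : (b -> 0 <= x) -> (0 <= y)%E -> (0 <= w b x y)%E.
  by rewrite /w; case: b => // /(_ erefl) ? ?; rewrite mule_ge0// lee_fin.
have mw d (T : measurableType d) (b : T -> bool) (x : T -> R) (y : T -> \bar R) :
    measurable_fun setT b -> measurable_fun setT x -> measurable_fun setT y ->
    measurable_fun setT (fun t => w (b t) (x t) (y t)).
  move=> mb mx my; apply: measurable_fun_ifT => //.
  by apply: emeasurable_funM => //; exact/measurable_EFinP.
have me : measurable_fun setT (fun p : measurableTypeR R * borelC R n => e p.2).
  exact: measurable_ennorm_snd.
have m1 : measurable_fun setT (fun p : measurableTypeR R * borelC R n => p.1 : R).
  exact: measurable_fst.
have m2 : measurable_fun setT (fun p : measurableTypeR R * borelC R n => p.2).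
  exact: measurable_snd.
have mV d (T : measurableType d) (f : T -> R) : measurable_fun setT f ->
    measurable_fun setT (fun t => (f t)^-1).
  by move=> mf; exact: (measurableT_comp measurable_invr mf).
have mS (F : measurableTypeR R * borelC R n -> \bar R) y :
    measurable_fun setT F -> measurable_fun setT (fun s : measurableTypeR R => F (s, y)).
  by move=> mF; apply: (measurableT_comp mF); exact: measurable_pair2.
have mY (F : measurableTypeR R * borelC R n -> \bar R) s :
    measurable_fun setT F -> measurable_fun setT (fun y : borelC R n => F (s, y)).
  by move=> mF; apply: (measurableT_comp mF); exact: measurable_pair1.
have e_ge0 y : 0 <= e y by exact: enorm_ge0.
(* [F1], [F2], [F3] are the integrands in the variables [(s, y)], [(l, y)] and [(l, x)]; the
   Jacobians are [|y|] for [s = l |y|] and [l ^ N] for [x = l y]. *)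
pose F1 (p : measurableTypeR R * borelC R n) : \bar R :=
  w [&& 0 < p.1, 0 < e p.2 & e p.2 <= 1] (p.1 ^+ N.-1)
    (G ((p.1 / e p.2)%:C *: (p.2 : 'rV[R[i]]_n))%R).
have mF1 : measurable_fun setT F1.
  apply: mw.
  - apply: measurable_and; first exact: measurable_fun_ltr.
    by apply: measurable_and; [exact: measurable_fun_ltr|exact: measurable_fun_ler].
  - exact: measurable_funX.
  - apply: (measurableT_comp mG); apply: measurable_scale_borelC => //.
    by apply: measurable_funM => //; exact: mV.
have F10 p : (0 <= F1 p)%E.
  by apply: w0 => // /and3P[/ltW ? _ _]; exact: exprn_ge0.
pose F2 (p : measurableTypeR R * borelC R n) : \bar R :=
  w [&& 0 < p.1, 0 < e p.2 & e p.2 <= 1] (e p.2 ^+ N * p.1 ^+ N.-1)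
    (G (p.1%:C *: (p.2 : 'rV[R[i]]_n))%R).
have mF2 : measurable_fun setT F2.
  apply: mw.
  - apply: measurable_and; first exact: measurable_fun_ltr.
    by apply: measurable_and; [exact: measurable_fun_ltr|exact: measurable_fun_ler].
  - by apply: measurable_funM; exact: measurable_funX.
  - by apply: (measurableT_comp mG); apply: measurable_scale_borelC.
have F20 p : (0 <= F2 p)%E.
  by apply: w0 => // /and3P[/ltW ? _ _]; rewrite mulr_ge0 ?exprn_ge0.
pose F3 (p : measurableTypeR R * borelC R n) : \bar R :=
  w [&& 0 < p.1, 0 < e p.2 & e p.2 <= p.1] (e p.2 ^+ N * p.1^-1 ^+ N.+1) (G p.2).
have mF3 : measurable_fun setT F3.
  apply: mw.
  - apply: measurable_and; first exact: measurable_fun_ltr.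
    by apply: measurable_and; [exact: measurable_fun_ltr|exact: measurable_fun_ler].
  - by apply: measurable_funM; apply: measurable_funX => //; exact: mV.
  - exact: (measurableT_comp mG).
have F30 p : (0 <= F3 p)%E.
  by apply: w0 => // /and3P[/ltW ? _ _]; rewrite mulr_ge0 ?exprn_ge0 ?invr_ge0.
transitivity (\int[leb]_s \int[@lebesgueC R n]_y F1 (s, y))%E.
  apply: eq_integral => s _; rewrite /radial_mean integral_mkcond.
  have m1s : measurable_fun setT (fun y : borelC R n =>
      ((fun y => G ((s / e y)%:C *: (y : 'rV[R[i]]_n))%R) \_ (@unit_shell n)) y).
    apply/(measurable_restrictT _ (@measurable_unit_shell n)).
    apply: measurable_funTS; apply: (measurableT_comp mG).
    apply: measurable_scale_borelC => //; apply: measurable_funM => //.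
    by apply: mV; exact: measurable_enorm.
  case: ifPn => s0; last first.
    rewrite mul0e; apply/esym/integral0_eq => y _.
    by rewrite /F1 /w /= (negbTE s0).
  rewrite -ge0_integralZl//; last 2 first.
  - by move=> y _; rewrite patchE; case: ifP.
  - by rewrite lee_fin exprn_ge0// ltW.
  apply: eq_integral => y _; rewrite /F1 /w /= s0 patchE /=.
  case: ifPn; first by rewrite inE /= => ->.
  by rewrite notin_setE /= => /negP/negbTE ->; rewrite mule0.
rewrite (fubini_tonelli F1 mF1 F10).
transitivity (\int[@lebesgueC R n]_y \int[leb]_s F2 (s, y))%E.
  apply: eq_integral => y _.
  have [/andP[y0 y1]|yN] := boolP ((0 < e y) && (e y <= 1)); last first.
    by rewrite /F1 /F2 /w /= !(negbTE yN); apply: eq_integral => s _; rewrite andbF.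
  rewrite (ge0_integral_dilation y0 (mS F1 y mF1) (fun=> F10 _)).
  apply: eq_integral => s _; rewrite /F1 /F2 /w /= y0 y1 !andbT pmulr_rgt0//.
  case: ifP => s0; last by rewrite mule0.
  rewrite muleA -EFinM; congr (_%:E * G _)%E.
    by rewrite exprMn mulrA -exprS prednK.
  by rewrite mulrAC divff ?mul1r// lt0r_neq0.
rewrite -(fubini_tonelli F2 mF2 F20).
transitivity (\int[leb]_s \int[@lebesgueC R n]_y F3 (s, y))%E.
  apply: eq_integral => s _.
  have [s0|sN] := boolP (0 < s); last first.
    by apply: eq_integral => y _; rewrite /F2 /F3 /w /= (negbTE sN).
  rewrite (ge0_integral_lebesgueC_dilation s0 (mY F3 s mF3) (fun=> F30 _)).
  apply: eq_integral => y _; rewrite /F2 /F3 /w /= s0 /=.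
  have -> : e (s%:C *: (y : 'rV[R[i]]_n)) = s * e y by rewrite /e enormZ gtr0_norm.
  have -> : (s * e y <= s) = (e y <= 1) by rewrite -{2}[s]mulr1 ler_pM2l.
  rewrite pmulr_rgt0//; case: ifP => _; last by rewrite mule0.
  rewrite muleA -EFinM; congr (_%:E * _)%E.
  have [p NE] : exists p, N = p.+1 by exists N.-1; rewrite prednK.
  rewrite -/N NE /= exprMn exprVn !exprS; field.
  by rewrite ?expf_neq0 ?lt0r_neq0.
rewrite (fubini_tonelli F3 mF3 F30) -ge0_integralZl//; last 3 first.
- apply: measurable_fun_ifT => //; apply: measurable_fun_ltr => //.
  exact: measurable_enorm.
- by move=> x _; case: ifP.
- by rewrite lee_fin ltW.
apply: eq_integral => x _; case: ifPn => x0; last first.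
  rewrite mule0; apply: integral0_eq => s _.
  by rewrite /F3 /w /= /e (negbTE x0) andbF.
(* With [l = |x| t] all powers of [|x|] cancel and the tail integral of [t^-(N+1)] over [t >= 1]
   remains; its value is the polar constant. *)
rewrite (ge0_integral_dilation x0 (mS F3 x mF3) (fun=> F30 _)) -cE muleC.
rewrite -ge0_integralZl//=; last 2 first.
- apply/measurable_EFinP; apply: measurable_fun_ifT => //.
  + exact: measurable_fun_ler.
  + by apply: measurable_funX; exact: measurable_invr.
- by move=> s _; rewrite lee_fin; case: ifP => // s1; rewrite exprn_ge0// invr_ge0; lra.
apply: eq_integral => s _; rewrite /F3 /w /= -/(e x) x0 pmulr_rgt0//=.
rewrite -{2}[e x]mulr1 ler_pM2l//; case: ifPn => [/andP[s0 s1]|]; last first.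
  rewrite negb_and mule0; case: ifPn => //= s1; last by rewrite mule0.
  by rewrite orbF => /negP []; lra.
rewrite s1 muleA -EFinM muleC; congr (_ * _%:E)%E.
rewrite invfM exprMn [_ ^+ N.+1]exprS !exprVn; field.
by rewrite ?expf_neq0 ?lt0r_neq0.
Qed.

End polar_coordinates.

(** * From vanishing spherical means to vanishing radially weighted integrals *)

Section sphere_means.
Context {R : realType}.
Local Open Scope complex_scope.
Local Notation leb := (@lebesgue_measure R).

Lemma measurable_csphere n (s : R) : measurable (@csphere R n s).
Proof.
rewrite (_ : @csphere R n s = (@enorm R n : borelC R n -> R) @^-1` [set s]).
  by rewrite -[X in measurable X]setTI; exact: measurable_enorm.
by apply/seteqP; split=> z.
Qed.

(** On subsets of the sphere, [sphere_measure] is a multiple of the image of Lebesgue measure under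
    radial projection; a dilation by [s] then moves the cone to [unit_shell]. The constant may
    depend on [s], since it only has to be cancelled. *)
Lemma sphere_integral n (s : {posnum R}) : (0 < n)%N -> exists2 k : R, 0 < k &
  forall F : borelC R n -> \bar R, measurable_fun setT F ->
  (forall x, 0 <= F x)%E ->
  (\int[@sphere_measure R n s]_(w in @csphere R n s%:num) F w =
   k%:E * radial_mean F s%:num)%E.
Proof.
(* Radial projection of the punctured ball of radius [s] onto its sphere; all other points go to 0,
   which is off the sphere. *)
move=> n0; pose rho (z : borelC R n) : borelC R n :=
  (if 0 < enorm (z : 'rV[R[i]]_n) <= s%:num
   then s%:num / enorm (z : 'rV[R[i]]_n) else 0)%:C *: (z : 'rV[R[i]]_n).
have mrho : measurable_fun setT rho.
  apply: measurable_scale_borelC => //; apply: measurable_fun_ifT => //.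
  - by apply: measurable_and; [apply: measurable_fun_ltr|apply: measurable_fun_ler] => //;
      exact: measurable_enorm.
  - apply: measurable_funM => //.
    exact: (measurableT_comp measurable_invr (@measurable_enorm R n)).
have m_gt0 : 0 < fine (@surface_measure R n s setT).
  by rewrite fine_gt0// surface_measure_setT_gt0// surface_measure_setT_lty.
have k0 : 0 < (n + n)%:R / s%:num / fine (@surface_measure R n s setT).
  by rewrite !divr_gt0// ltr0n addn_gt0 n0.
set k := (X in 0 < X) in k0.
have ksn : 0 < k * s%:num ^+ (n + n) by rewrite mulr_gt0// exprn_gt0.
exists (k * s%:num ^+ (n + n)) => // F mF F0.
pose nu : {measure set (borelC R n) -> \bar R} :=
  mscale (NngNum (ltW k0)) (pushforward (@lebesgueC R n) rho).
have enorm_rho (z : borelC R n) : 0 < enorm (z : 'rV[R[i]]_n) ->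
    enorm ((s%:num / enorm (z : 'rV[R[i]]_n))%:C *: (z : 'rV[R[i]]_n)) = s%:num.
  by move=> z0; rewrite enormZ gtr0_norm ?divr_gt0// divfK// gt_eqF.
rewrite (eq_measure_integral (nu mrho)); last first.
  move=> A mA AD; rewrite -[RHS]/(k%:E * @lebesgueC R n (rho @^-1` A))%E.
  rewrite [LHS](@sphere_measureE R n s A n0) /surface_measure muleAC -EFinM.
  congr (_ * @lebesgueC R n _)%E; apply/seteqP; split=> z; rewrite /sector /rho /=.
    by move=> [-> Az].
  case: ifP => // _; rewrite scale0r => /AD /=; rewrite /csphere /=.
  move=> e0; have := @enormZ R n 0 0; rewrite scale0r e0 normr0 mul0r => /eqP.
  by rewrite gt_eqF.
rewrite ge0_integral_mscale//; last 2 first.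
- exact: measurable_csphere.
- exact: measurable_funTS.
rewrite ge0_integral_pushforward//; last 2 first.
- exact: measurable_csphere.
- exact: measurable_funTS.
rewrite [(k * _)%:E]EFinM -muleA; congr (_ * _)%E.
rewrite [LHS]integral_mkcond /radial_mean [X in (_ * X)%E]integral_mkcond.
have mFr (a : R) : measurable_fun setT (fun y : borelC R n =>
    F ((a / enorm (y : 'rV[R[i]]_n))%:C *: (y : 'rV[R[i]]_n))%R).
  apply: (measurableT_comp mF); apply: measurable_scale_borelC => //.
  apply: measurable_funM => //.
  exact: (measurableT_comp measurable_invr (@measurable_enorm R n)).
rewrite -(@ge0_integralZl _ _ _ (@lebesgueC R n) setT measurableT); last 3 first.
- by apply/(measurable_restrictT _ (@measurable_unit_shell R n)); exact: measurable_funTS.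
- by move=> y _; rewrite patchE; case: ifP.
- by rewrite lee_fin exprn_ge0.
have s_gt0 : 0 < s%:num by [].
have mpre : measurable (rho @^-1` @csphere R n s%:num).
  by rewrite -[X in measurable X]setTI; apply: mrho => //; exact: measurable_csphere.
rewrite (ge0_integral_lebesgueC_dilation s_gt0); last 2 first.
- apply/(measurable_restrictT _ mpre); apply: measurable_funTS.
  exact: (measurableT_comp mF mrho).
- by move=> y; rewrite patchE; case: ifP => // _; exact: F0.
apply: eq_integral => y _; congr (_ * _)%E; rewrite !patchE.
have eE : enorm (s%:num%:C *: (y : 'rV[R[i]]_n)) = s%:num * enorm (y : 'rV[R[i]]_n).
  by rewrite enormZ gtr0_norm.
have -> : (s%:num%:C *: (y : 'rV[R[i]]_n) \in rho @^-1` @csphere R n s%:num) =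
    (y \in @unit_shell R n).
  rewrite !unfold_in; apply/asboolP/asboolP; rewrite /unit_shell /csphere /rho /=.
    case: ifP => [yI _|_].
      by move: yI; rewrite eE pmulr_rgt0// -{2}[s%:num]mulr1 ler_pM2l.
    rewrite enormZ normr0 mul0r => e0; have := s_gt0; rewrite -e0 ltxx//.
  move=> ye; rewrite eE pmulr_rgt0// -{2}[s%:num]mulr1 ler_pM2l// ye -eE.
  by apply: enorm_rho; rewrite eE pmulr_rgt0//; case/andP: ye.
case: ifPn => // /set_mem/andP[y0 y1]; rewrite /= /rho eE pmulr_rgt0// y0 /=.
rewrite -{2}[s%:num]mulr1 ler_pM2l// y1 scalerA -rmorphM /=; congr (F (_%:C *: _)).
by field; rewrite gt_eqF//= gt_eqF.
Qed.

(** The means of the positive and negative parts of [F] are finite, as [F] is bounded, hence equal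
    wherever [phi] is nonzero; polar integration of each part carries the equality over to the whole
    space. The condition [phi 0 = 0] covers the origin, which the polar formula leaves out. *)
Lemma integral_vanishing_means n (F : borelC R n -> R) (phi : R -> R) (B : R) :
  (0 < n)%N -> measurable_fun setT F -> (forall x, `|F x| <= B) ->
  measurable_fun setT phi -> (forall t, 0 <= phi t) -> phi 0 = 0 ->
  (forall s : {posnum R}, phi s%:num != 0 ->
    \int[@sphere_measure R n s]_(w in @csphere R n s%:num) F w = 0) ->
  \int[@lebesgueC R n]_w (phi (enorm (w : 'rV[R[i]]_n)) * F w) = 0.
Proof.
move=> n0 mF FB mphi phi0 phi00 means0.
have [c c0 polar] := @polar_integral R n n0.
have mphie : measurable_fun setT (fun w : borelC R n => phi (enorm (w : 'rV[R[i]]_n))).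
  exact: (measurableT_comp mphi (@measurable_enorm R n)).
have part (F' : borelC R n -> R) : measurable_fun setT F' -> (forall x, 0 <= F' x) ->
    (forall s : {posnum R}, radial_mean (fun w => (phi (enorm (w : 'rV[R[i]]_n)) * F' w)%:E)
      s%:num = (phi s%:num)%:E * radial_mean (EFin \o F') s%:num)%E /\
    (\int[leb]_s ((if (0 < s)%R then s ^+ (n + n).-1 else 0)%R%:E *
       radial_mean (fun w => (phi (enorm (w : 'rV[R[i]]_n)) * F' w)%:E) s) =
     c%:E * \int[@lebesgueC R n]_w (phi (enorm (w : 'rV[R[i]]_n)) * F' w)%:E)%E.
  move=> mF' F'0; split.
    move=> s; rewrite /radial_mean -ge0_integralZl ?lee_fin//.
    - apply: eq_integral => y /set_mem/andP[y0 y1].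
      rewrite enormZ gtr0_norm ?divr_gt0// divfK ?gt_eqF//.
    - exact: measurable_unit_shell.
    - apply: measurable_funTS; apply/measurable_EFinP; apply: (measurableT_comp mF').
      apply: measurable_scale_borelC => //; apply: measurable_funM => //.
      exact: (measurableT_comp measurable_invr (@measurable_enorm R n)).
    - by move=> y _; rewrite lee_fin.
  rewrite polar//.
  - congr (_ * _)%E; apply: eq_integral => w _; case: ifPn => //.
    rewrite -leNgt => w0; have -> : enorm (w : 'rV[R[i]]_n) = 0.
      by apply/eqP; rewrite eq_le w0 enorm_ge0.
    by rewrite phi00 mul0r.
  - by apply/measurable_EFinP; exact: measurable_funM.
  - by move=> w; rewrite lee_fin mulr_ge0.
pose Fp x := Num.max (F x) 0; pose Fm x := Num.max (- F x) 0.
have mFp : measurable_fun setT Fp by exact: measurable_funrpos.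
have mFm : measurable_fun setT Fm by exact: measurable_funrneg.
have Fp0 x : 0 <= Fp x by rewrite le_max lexx orbT.
have Fm0 x : 0 <= Fm x by rewrite le_max lexx orbT.
have [pE polarp] := part _ mFp Fp0; have [mE polarm] := part _ mFm Fm0.
have radial_eq (s : {posnum R}) : phi s%:num != 0 ->
    radial_mean (EFin \o Fp) s%:num = radial_mean (EFin \o Fm) s%:num.
  move=> /means0 Fs; have [k k0 kE] := @sphere_integral n s n0.
  have fin_part (F' : borelC R n -> R) : measurable_fun setT F' ->
      (forall x, 0 <= F' x <= B) ->
      (\int[@sphere_measure R n s]_(w in @csphere R n s%:num) (F' w)%:E \is a fin_num)%E.
    move=> mF' F'B; rewrite ge0_fin_numE; last first.
      by apply: integral_ge0 => w _; rewrite lee_fin; case/andP: (F'B w).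
    apply: (@le_lt_trans _ _
        (\int[@sphere_measure R n s]_(w in @csphere R n s%:num) (cst B%:E) w)%E).
      apply: ge0_le_integral => //.
      - exact: measurable_csphere.
      - by move=> w _; rewrite lee_fin; case/andP: (F'B w).
      - by apply/measurable_EFinP; exact: measurable_funTS.
      - by move=> w _; rewrite lee_fin; case/andP: (F'B w).
    rewrite integral_cst; last exact: measurable_csphere.
    rewrite lte_mul_pinfty// ?lee_fin.
      exact: le_trans (FB (0 : 'rV_n)).
    by apply: (le_lt_trans (@probability_le1 _ _ _ _ _ _)); rewrite ?ltry//; exact: measurable_csphere.
  have finp := fin_part _ mFp _; have finm := fin_part _ mFm _.
  have {}finp : (\int[@sphere_measure R n s]_(w in @csphere R n s%:num) (Fp w)%:E \is a fin_num)%E.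
    by apply: finp => x; rewrite Fp0 ge_max (le_trans (ler_norm _))//= (le_trans _ (FB x)).
  have {}finm : (\int[@sphere_measure R n s]_(w in @csphere R n s%:num) (Fm w)%:E \is a fin_num)%E.
    apply: finm => x; rewrite Fm0 ge_max (le_trans _ (FB x)) ?(le_trans _ (FB x))//=.
    by rewrite -normrN ler_norm.
  have : (\int[@sphere_measure R n s]_(w in @csphere R n s%:num) (Fp w)%:E =
      \int[@sphere_measure R n s]_(w in @csphere R n s%:num) (Fm w)%:E)%E.
    move: Fs; rewrite /Rintegral integralE.
    under eq_integral do rewrite funeposE -EFin_max -/(Fp _).
    under [in X in (_ - X)%E]eq_integral do rewrite funenegE -EFinN -EFin_max -/(Fm _).
    move: finp finm => /fineK <- /fineK <-; rewrite -EFinB /= => /eqP.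
    by rewrite subr_eq0 => /eqP ->.
  rewrite !kE; try by [move=> x; rewrite lee_fin|apply/measurable_EFinP].
  move=> /(congr1 (fun x => ((k^-1)%:E * x)%E)).
  by rewrite !muleA -EFinM mulVf ?mul1e// gt_eqF.
have {polarp polarm} : (c%:E * \int[@lebesgueC R n]_w (phi (enorm (w : 'rV[R[i]]_n)) * Fp w)%:E =
    c%:E * \int[@lebesgueC R n]_w (phi (enorm (w : 'rV[R[i]]_n)) * Fm w)%:E)%E.
  rewrite -polarp -polarm; apply: eq_integral => s _.
  have [s0|s0] := ltP 0 s; last by rewrite !mul0e.
  have [z0|nz] := eqVneq (phi s) 0.
    by rewrite -[s]/((PosNum s0)%:num) pE mE /= z0 !mul0e.
  by rewrite -[s]/((PosNum s0)%:num) pE mE radial_eq.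
move=> /(congr1 (fun x => ((c^-1)%:E * x)%E)).
rewrite !muleA -EFinM mulVf ?gt_eqF// !mul1e => pmE.
rewrite /Rintegral integralE.
rewrite (eq_integral (fun w : borelC R n => (phi (enorm (w : 'rV[R[i]]_n)) * Fp w)%:E)); last first.
  by move=> w _; rewrite funeposE -EFin_max maxr_pMr// mulr0.
rewrite [X in (_ - X)%E](eq_integral (fun w : borelC R n => (phi (enorm (w : 'rV[R[i]]_n)) * Fm w)%:E)); last first.
  by move=> w _; rewrite funenegE -EFinN -EFin_max maxr_pMr// mulr0 mulrN.
(* No finiteness is required here: when the common value is infinite, so is the difference, and
   [fine] sends it to 0. *)
by rewrite pmE; case: (\int[_]_w _)%E => [x||] //=; rewrite subrr.
Qed.

End sphere_means.

(** * An integrable majorant on C^n *)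

Section integrability.
Context {R : realType}.
Local Open Scope complex_scope.
Local Notation leb := (@lebesgue_measure R).

Lemma integral_tuple_prod n (g : R -> R) (I : R) : measurable_fun setT g ->
  (forall x, 0 <= g x) -> (\int[leb]_x (g x)%:E = I%:E)%E ->
  (\int[tuple_measure leb n]_t (\prod_(i < n) g (tnth t i))%:E = (I ^+ n)%:E)%E.
Proof.
move=> mg g0 gI.
have mprod m : measurable_fun setT (fun t : m.-tuple R => (\prod_(i < m) g (tnth t i))%:E).
  apply/measurable_EFinP; apply: measurable_prod => i _.
  exact: (measurableT_comp mg (measurable_tnth _)).
elim: n => [|n IHn].
  rewrite /= integral_dirac//; last exact: mprod.
  by rewrite big_ord0 diracT mul1e expr0.
have I0 : 0 <= I.
  by rewrite -lee_fin -gI; apply: integral_ge0 => x _; rewrite lee_fin.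
rewrite ge0_integral_tuple; [|exact: mprod|by move=> t; rewrite lee_fin prodr_ge0].
transitivity (\int[leb]_x ((I ^+ n)%:E * (g x)%:E))%E.
  apply: eq_integral => x _; rewrite -IHn muleC.
  rewrite -(@ge0_integralZl _ _ _ (tuple_measure leb n) setT measurableT _ (mprod n))//.
  - apply: eq_integral => t _; rewrite big_ord_recl -EFinM tnth0; congr (_ * _)%:E.
    by apply: eq_bigr => i _; rewrite tnthS.
  - by move=> t _; rewrite lee_fin prodr_ge0.
  - by rewrite lee_fin.
have mgE : measurable_fun setT (fun x : measurableTypeR R => (g x)%:E).
  exact/measurable_EFinP.
rewrite (@ge0_integralZl _ _ _ leb setT measurableT _ mgE)//.
- by rewrite gI -EFinM exprSr.
- by move=> x _; rewrite lee_fin.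
- by rewrite lee_fin exprn_ge0.
Qed.

(** The scale for growth and decay: at least 1, so its powers are ordered by their exponents, and
    integrable to the power [-2n]. *)
Definition weight n (z : 'rV[R[i]]_n) : R := 1 + enorm z ^+ 2.

Lemma weight_ge1 n (z : 'rV[R[i]]_n) : 1 <= weight z.
Proof. by rewrite lerDl sqr_ge0. Qed.

Lemma weight_gt0 n (z : 'rV[R[i]]_n) : 0 < weight z.
Proof. exact: lt_le_trans (weight_ge1 z). Qed.

Lemma measurable_weight n : measurable_fun setT (@weight n : borelC R n -> R).
Proof.
by apply: measurable_funD => //; apply: measurable_funX; exact: measurable_enorm.
Qed.

(** Every real coordinate satisfies [x_i^2 <= |z|^2], so the function is dominated by the product of
    the [1 / (1 + x_i^2)], whose integral is [pi ^ (2n)]. *)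
Lemma integrable_weight n : (@lebesgueC R n).-integrable setT
  (fun z : borelC R n => ((weight (z : 'rV[R[i]]_n))^-1 ^+ (n + n))%:E).
Proof.
have mw : measurable_fun setT
    (fun z : borelC R n => ((weight (z : 'rV[R[i]]_n))^-1 ^+ (n + n))%:E).
  apply/measurable_EFinP; apply: measurable_funX.
  exact: (measurableT_comp measurable_invr (@measurable_weight n)).
have w0 (z : borelC R n) : (0 <= ((weight (z : 'rV[R[i]]_n))^-1 ^+ (n + n))%:E)%E.
  by rewrite lee_fin exprn_ge0// invr_ge0 ltW// weight_gt0.
apply/integrableP; split=> //.
under eq_integral do rewrite gee0_abs//.
rewrite ge0_integral_lebesgueC//.
have mg : measurable_fun setT (fun x : R => (oneDsqr x)^-1).
  by apply: continuous_measurable_fun; exact: continuous_oneDsqrV.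
have gI : (\int[leb]_x ((oneDsqr x)^-1)%:E = pi%:E)%E.
  rewrite (ge0_symfun_integralT _ (@continuous_oneDsqrV R)).
  - by rewrite -set_itvcy integral0y_oneDsqr -EFinM mulrC divfK.
  - by move=> x; rewrite invr_ge0.
  - by move=> x /=; rewrite /oneDsqr sqrrN.
apply: (@le_lt_trans _ _ (\int[tuple_measure leb (n + n)]_t
    (\prod_(i < n + n) (oneDsqr (tnth t i))^-1)%:E)%E); last first.
  by rewrite (integral_tuple_prod _ mg _ gI) ?ltry// => x; rewrite invr_ge0.
apply: ge0_le_integral => //.
- by apply: (measurableT_comp mw); exact: measurable_row_of_coords.
- apply/measurable_EFinP; apply: measurable_prod => i _.
  exact: (measurableT_comp mg (measurable_tnth _)).
move=> t _; rewrite lee_fin -[X in _ ^+ X]card_ord -prodr_const.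
apply: ler_prod => i _; rewrite invr_ge0 ltW ?weight_gt0//=.
rewrite lef_pV2 ?posrE ?weight_gt0 ?oneDsqr_gt0// /oneDsqr /weight lerD2l enorm_sqr.
have [j iE] : exists j : 'I_n, i = lshift n j \/ i = rshift n j.
  by case: (fintype.splitP i) => j ij; exists j; [left|right]; exact/val_inj.
rewrite (bigD1 j)//= mxE /= ler_wpDr ?sumr_ge0// => [l _|].
  by rewrite addr_ge0 ?sqr_ge0.
by case: iE => ->; rewrite ?lerDl ?lerDr sqr_ge0.
Qed.

End integrability.

(** * The kernels [K_N] and their differences *)

Section kernels.
Context {R : realType}.

(** [K_N] of the overview, a term of the exponential series at [max x 0 / 2]. For [N = 0] it is the
    constant 1 and not the indicator of [x > 0], so only indices [N >= 1] cut off the region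
    [x <= 0]. *)
Definition truncated_power (N : nat) (x : R) : R :=
  (Num.max x 0 / 2) ^+ N / N`!%:R.

(* The [b]-th forward difference in [N]. *)
Fixpoint kernel (b N : nat) (x : R) : R :=
  if b is b'.+1 then kernel b' N.+1 x - kernel b' N x else truncated_power N x.

Lemma truncated_power_ge0 N x : 0 <= truncated_power N x.
Proof. by rewrite divr_ge0// exprn_ge0// divr_ge0// le_max lexx orbT. Qed.

Lemma truncated_power_eq0 N x : x <= 0 -> truncated_power N.+1 x = 0.
Proof. by move=> x0; rewrite /truncated_power max_r// !mul0r expr0n mul0r. Qed.

Lemma truncated_power_le N x y : 1 <= y -> `|x| <= y -> truncated_power N x <= y ^+ N.
Proof.
move=> y1 xy; have f1 : 1 <= N`!%:R :> R by rewrite ler1n fact_gt0.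
have mx : 0 <= Num.max x 0 <= y.
  by rewrite le_max lexx orbT ge_max (le_trans (ler_norm x) xy) (le_trans ler01 y1).
rewrite /truncated_power ler_pdivrMr; last by rewrite ltr0n fact_gt0.
apply: (@le_trans _ _ (y ^+ N)).
  by rewrite lerXn2r// ?nnegrE; case/andP: mx => ? ?; lra.
by rewrite ler_peMr// exprn_ge0//; lra.
Qed.

Lemma kernel_bound b N x y : 1 <= y -> `|x| <= y ->
  `|kernel b N x| <= 2 ^+ b * y ^+ (N + b).
Proof.
move=> y1 xy; elim: b N => [|b IHb] N /=.
  by rewrite expr0 mul1r addn0 ger0_norm ?truncated_power_ge0// truncated_power_le.
apply: (le_trans (ler_normB _ _)).
have := IHb N.+1; have := IHb N; rewrite addSnnS.
have : 2 ^+ b * y ^+ (N + b) <= 2 ^+ b * y ^+ (N + b.+1).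
  by rewrite ler_pM2l ?exprn_gt0// ler_weXn2l// addnS.
by rewrite exprS => ? ? ?; lra.
Qed.

Lemma measurable_truncated_power N : measurable_fun setT (truncated_power N).
Proof.
apply: measurable_funM => //; apply: measurable_funX; apply: measurable_funM => //.
exact: measurable_maxr.
Qed.

Lemma measurable_kernel b N : measurable_fun setT (kernel b N).
Proof.
elim: b N => [|b IHb] N; first exact: measurable_truncated_power.
by apply: measurable_funB.
Qed.

(** A criterion suited to functions with a kink in the derivative, such as [max x 0 ^ 2], and to
    quadratic polynomials. *)
Lemma is_derive_quadratic_remainder (f : R -> R) (x d C : R) :
  (forall h, `|f (x + h) - f x - h * d| <= C * h ^+ 2) -> is_derive x 1 f d.
Proof.
move=> fE; have C0 : 0 <= C.
  by have := fE 1; rewrite expr1n mulr1; apply: le_trans.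
suff fd : h^-1 *: ((f \o shift x) (h *: 1) - f x) @[h --> 0^'] --> d.
  by split; [apply/cvg_ex; exists d|exact: cvg_lim].
apply/cvgrPdist_le => e e0; near=> h.
have h0 : h != 0 by near: h; exact: nbhs_dnbhs_neq.
have nh : 0 < `|h| by rewrite normr_gt0.
rewrite /= [h *: 1]mulr1 [h + x]addrC.
rewrite [_ *: _](_ : _ = h^-1 * (f (x + h) - f x))// distrC.
have -> : h^-1 * (f (x + h) - f x) - d = h^-1 * (f (x + h) - f x - h * d).
  by field.
rewrite normrM normfV ler_pdivrMl// (le_trans (fE h))//.
rewrite -[h ^+ 2]real_normK ?num_real// expr2 mulrCA ler_pM2l// mulrC.
(* [C + 1] instead of [C], which may be 0. *)
have he : `|h| <= e / (C + 1).
  near: h; apply: dnbhs0_le; rewrite divr_gt0//; lra.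
apply: (@le_trans _ _ (e / (C + 1) * C)); first by rewrite ler_wpM2r.
by rewrite mulrAC ler_pdivrMr; [rewrite ler_pM2l//; lra|lra].
Unshelve. all: by end_near. Qed.

Lemma is_derive_truncated_power N (x : R) : (0 < N)%N ->
  is_derive x 1 (truncated_power N.+1) (2^-1 * truncated_power N x).
Proof.
have sqr_max (y h : R) : `|Num.max (y + h) 0 ^+ 2 - Num.max y 0 ^+ 2 -
    h * (2 * Num.max y 0)| <= 1 * h ^+ 2.
  rewrite mul1r ler_norml.
  case: (leP y 0) => y0; case: (leP (y + h) 0) => yh; apply/andP; split; nra.
(* The induction starts at the square because [max y 0] is not differentiable at 0, whence [0 < N].
   The step uses [max y 0 ^ (m+3) = y * max y 0 ^ (m+2)]. *)
have dpow m (y : R) : is_derive y 1 (fun y => Num.max y 0 ^+ m.+2)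
    (m.+2%:R * Num.max y 0 ^+ m.+1).
  elim: m y => [|m IHm] y.
    by apply: (is_derive_quadratic_remainder (C := 1)) => h; exact: sqr_max.
  have -> : (fun y : R => Num.max y 0 ^+ m.+3) = id * (fun y => Num.max y 0 ^+ m.+2).
    apply/funext => t; rewrite [RHS](_ : _ = t * Num.max t 0 ^+ m.+2)// exprS.
    by case: (leP t 0) => // _; rewrite expr0n !mulr0.
  have d := is_deriveM (is_derive_id y (1 : R)) (IHm y).
  apply: (is_derive_eq d); rewrite /GRing.scale /= mulr1.
  case: (leP y 0) => y0; first by rewrite !expr0n !mulr0 addr0.
  have -> : m.+3%:R = m.+2%:R + 1 :> R by rewrite natr1.
  by rewrite [y ^+ m.+2]exprS; move: (m.+2%:R) (y ^+ m.+1) => a b; ring.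
case: N => // N _.
have -> : truncated_power N.+2 =
    (2^-1 ^+ N.+2 / N.+2`!%:R) *: (fun y : R => Num.max y 0 ^+ N.+2).
  apply/funext => y.
  rewrite [RHS](_ : _ = 2^-1 ^+ N.+2 / N.+2`!%:R * Num.max y 0 ^+ N.+2)//.
  by rewrite /truncated_power exprMn [_ * 2^-1 ^+ _]mulrC mulrAC.
apply: is_derive_eq; rewrite /truncated_power /GRing.scale /= exprMn factS natrM.
have f0 : N.+1`!%:R != 0 :> R by rewrite pnatr_eq0 -lt0n fact_gt0.
have n0 : N.+2%:R != 0 :> R by rewrite pnatr_eq0.
rewrite [2^-1 ^+ N.+2]exprS; move: (N.+2%:R) (2^-1 ^+ N.+1) n0 => a b n0.
by field; rewrite f0 n0.
Qed.

Lemma is_derive_kernel b N (x : R) : (0 < N)%N ->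
  is_derive x 1 (kernel b N.+1) (2^-1 * kernel b N x).
Proof.
elim: b N => [|b IHb] N N0; first exact: is_derive_truncated_power.
rewrite /=; have d1 := IHb N.+1 isT; have d2 := IHb N N0.
by rewrite mulrBr; apply: is_deriveB.
Qed.

(** The bound uniform in [N], from [1 + x^(N+1) / (N+1)! <= e^x]; it supplies the majorant for the
    limit [N -> oo]. *)
Lemma truncated_power_le_expR N (x : R) :
  truncated_power N.+1 x <= expR (Num.max x 0 / 2).
Proof.
have m0 : 0 <= Num.max x 0 / 2 by rewrite divr_ge0// le_max lexx orbT.
by rewrite (le_trans _ (expR_ge1Dxn N m0))// lerDr.
Qed.

Lemma cvg_truncated_power (x : R) : truncated_power N x @[N --> \oo] --> 0.
Proof.
by apply: (@cvg_series_cvg_0 R R^o (exp_coeff (Num.max x 0 / 2)));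
  exact: is_cvg_series_exp_coeff.
Qed.

End kernels.

(** * The complex exponential and the Hermitian form *)

Section hermitian.
Context {R : realType}.
Local Open Scope complex_scope.

Lemma normc_ge0 (x : R[i]) : 0 <= normc x.
Proof. by case: x => a b; exact: sqrtr_ge0. Qed.

Lemma normc_Re (x : R[i]) : `|complex.Re x| <= normc x.
Proof. by case: x => a b /=; rewrite -sqrtr_sqr ler_wsqrtr// lerDl sqr_ge0. Qed.

Lemma normc_le_ReIm (x : R[i]) : normc x <= `|complex.Re x| + `|complex.Im x|.
Proof.
case: x => a b /=; rewrite -[leRHS]ger0_norm ?addr_ge0// -sqrtr_sqr ler_wsqrtr//.
rewrite [leRHS]sqrrD !real_normK ?num_real// addrAC lerDl.
by rewrite mulrn_wge0// mulr_ge0.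
Qed.

Lemma ReM (x y : R[i]) : complex.Re (x * y) =
  complex.Re x * complex.Re y - complex.Im x * complex.Im y.
Proof. by case: x y => [a b] [c d]. Qed.

Lemma ImM (x y : R[i]) : complex.Im (x * y) =
  complex.Re x * complex.Im y + complex.Im x * complex.Re y.
Proof. by case: x y => [a b] [c d] /=; rewrite addrC [_ * c]mulrC [a * d]mulrC addrC mulrC [c * b]mulrC. Qed.

Lemma Re_real (c : R) (x : R[i]) : complex.Re (c%:C * x) = c * complex.Re x.
Proof. by rewrite ReM /= mul0r subr0. Qed.

Lemma Im_real (c : R) (x : R[i]) : complex.Im (c%:C * x) = c * complex.Im x.
Proof. by rewrite ImM /= mul0r addr0. Qed.

Lemma Re_half (x : R[i]) : complex.Re (x / 2%:R) = complex.Re x / 2.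
Proof.
have -> : (2%:R : R[i])^-1 = (2^-1)%:C by rewrite rmorphV ?unitfE// rmorph_nat.
by rewrite mulrC Re_real mulrC.
Qed.

Lemma Im_half (x : R[i]) : complex.Im (x / 2%:R) = complex.Im x / 2.
Proof.
have -> : (2%:R : R[i])^-1 = (2^-1)%:C by rewrite rmorphV ?unitfE// rmorph_nat.
by rewrite mulrC Im_real mulrC.
Qed.

Definition cexp (a : R[i]) : R[i] := (expR (complex.Re a))%:C * expi (complex.Im a).

Lemma normc_expi (t : R) : normc (expi t) = 1.
Proof. by rewrite /= cos2Dsin2 sqrtr1. Qed.

Lemma normc_cexp (a : R[i]) : normc (cexp a) = expR (complex.Re a).
Proof.
by rewrite /cexp normcM normc_expi mulr1 /= expr0n addr0 sqrtr_sqr ger0_norm ?expR_ge0.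
Qed.

Lemma cexp0 : cexp 0 = 1.
Proof. by rewrite /cexp /expi /= expR0 cos0 sin0 mul1r. Qed.

Section herm_form.
Variable n : nat.
Implicit Types (z u v w : 'rV[R[i]]_n).

Definition herm z u : R[i] := \sum_j (z 0 j)^* * u 0 j.

Lemma hermDl z z' u : herm (z + z') u = herm z u + herm z' u.
Proof.
by rewrite /herm -big_split; apply: eq_bigr => j _; rewrite mxE rmorphD mulrDl.
Qed.

Lemma hermZl (c : R[i]) z u : herm (c *: z) u = c^* * herm z u.
Proof.
by rewrite /herm mulr_sumr; apply: eq_bigr => j _; rewrite mxE rmorphM mulrA.
Qed.

Lemma hermNl z u : herm (- z) u = - herm z u.
Proof. by rewrite /herm -sumrN; apply: eq_bigr => j _; rewrite mxE rmorphN mulNr. Qed.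

Lemma enormN z : enorm (- z) = enorm z.
Proof.
apply/eqP; rewrite -(@eqrXn2 _ 2)// ?enorm_ge0// !enorm_sqr; apply/eqP.
by apply: eq_bigr => j _; rewrite mxE; case: (z 0 j) => a b /=; ring.
Qed.

Lemma hermBr z u u' : herm z (u - u') = herm z u - herm z u'.
Proof. by rewrite /herm -sumrB; apply: eq_bigr => j _; rewrite !mxE mulrBr. Qed.

Lemma herm0l u : herm 0 u = 0.
Proof. by rewrite /herm big1// => j _; rewrite mxE rmorph0 mul0r. Qed.

Lemma enormB_sqr u v : enorm (u - v) ^+ 2 =
  enorm u ^+ 2 + enorm v ^+ 2 - 2 * complex.Re (herm v u).
Proof.
rewrite !enorm_sqr /herm raddf_sum mulr_sumr -big_split -sumrB /=.
apply: eq_bigr => j _; rewrite !mxE; case: (u 0 j) (v 0 j) => [a b] [c d] /=; ring.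
Qed.

Lemma enormBZ_sqr u v (t : R) : enorm (u - t%:C *: v) ^+ 2 =
  enorm u ^+ 2 - t * (2 * complex.Re (herm v u)) + t ^+ 2 * enorm v ^+ 2.
Proof.
rewrite enormB_sqr enormZ exprMn real_normK ?num_real//.
have -> : herm (t%:C *: v) u = t%:C * herm v u.
  by rewrite hermZl; congr (_ * _); apply/eqP; rewrite eq_complex /= oppr0 !eqxx.
by rewrite Re_real; ring.
Qed.

(** Both [|u - z|^2] and [|u + z|^2] are nonnegative. Growth estimates need no more than this form
    of the Cauchy-Schwarz inequality. *)
Lemma Re_herm_le z u : `|complex.Re (herm z u)| <= (enorm z ^+ 2 + enorm u ^+ 2) / 2.
Proof.
have := sqr_ge0 (enorm (u - z)); have := sqr_ge0 (enorm (u - - z)).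
rewrite !enormB_sqr hermNl enormN raddfN /= ler_norml.
by move: (complex.Re _) (enorm u ^+ 2) (enorm z ^+ 2) => a b c h1 h2; apply/andP; split; lra.
Qed.

Lemma enormi z : enorm ((0 +i* 1) *: z) = enorm z.
Proof.
apply/eqP; rewrite -(@eqrXn2 _ 2)// ?enorm_ge0// !enorm_sqr; apply/eqP.
by apply: eq_bigr => j _; rewrite mxE; case: (z 0 j) => a b /=; ring.
Qed.

(** Imaginary parts are real parts along [i z], so statements about [Re] transfer to [Im]. *)
Lemma Re_hermi z u : complex.Re (herm ((0 +i* 1) *: z) u) = complex.Im (herm z u).
Proof. by rewrite hermZl ReM /=; ring. Qed.

Lemma Im_herm_le z u : `|complex.Im (herm z u)| <= (enorm z ^+ 2 + enorm u ^+ 2) / 2.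
Proof. by rewrite -Re_hermi -(enormi z) Re_herm_le. Qed.

Lemma measurable_Re_herm z :
  measurable_fun setT (fun u : borelC R n => complex.Re (herm z (u : 'rV[R[i]]_n))).
Proof.
rewrite (_ : (fun _ => _) = fun u : borelC R n => \sum_j
    (complex.Re (z 0 j) * complex.Re ((u : 'rV[R[i]]_n) 0 j) +
     complex.Im (z 0 j) * complex.Im ((u : 'rV[R[i]]_n) 0 j))).
  apply: measurable_sum => j; apply: measurable_funD; apply: measurable_funM => //.
  - exact: measurable_Re_coord.
  - exact: measurable_Im_coord.
apply/funext => u; rewrite /herm raddf_sum; apply: eq_bigr => j _.
by case: (z 0 j) ((u : 'rV__) 0 j) => [a b] [c d] /=; ring.
Qed.

Lemma measurable_Im_herm z :
  measurable_fun setT (fun u : borelC R n => complex.Im (herm z (u : 'rV[R[i]]_n))).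
Proof.
under eq_fun do rewrite -Re_hermi.
exact: measurable_Re_herm.
Qed.

Lemma measurable_enormB z :
  measurable_fun setT (fun u : borelC R n => enorm ((u : 'rV[R[i]]_n) - z) ^+ 2).
Proof.
under eq_fun do rewrite enormB_sqr.
apply: measurable_funB; last by apply: measurable_funM => //; exact: measurable_Re_herm.
by apply: measurable_funD => //; apply: measurable_funX; exact: measurable_enorm.
Qed.

(** [Re_herm_le] yields the exponent [|u|^2 / 4]; it is enlarged to [|u|^2 / 2], the growth that
    [rapid] absorbs. *)
Lemma Re_cexp_herm_le z u (y : R[i]) :
  `|complex.Re (cexp (herm z u / 2%:R) * y)| <=
  expR (enorm z ^+ 2 / 4) * expR (enorm u ^+ 2 / 2) * normc y.
Proof.
apply: (le_trans (normc_Re _)); rewrite normcM normc_cexp.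
apply: ler_wpM2r; first exact: normc_ge0.
rewrite -expRD ler_expR.
rewrite Re_half; have := ler_norm (complex.Re (herm z u)); have := Re_herm_le z u.
have := sqr_ge0 (enorm u); have := sqr_ge0 (enorm z).
by move: (complex.Re _) (enorm u ^+ 2) (enorm z ^+ 2) => a b c h1 h2 h3 h4; lra.
Qed.

End herm_form.
End hermitian.

(** * Rapid decay, moments and their integrands *)

Section rapidly_decaying_functions.
Context {R : realType} (n : nat).
Local Open Scope complex_scope.
Local Notation leb := (@lebesgueC R n).
Implicit Types (z v : 'rV[R[i]]_n) (h : 'rV[R[i]]_n -> R[i]) (u : borelC R n).

Definition cmeasurable (g : borelC R n -> R[i]) : Prop :=
  measurable_fun setT (fun u => complex.Re (g u)) /\
  measurable_fun setT (fun u => complex.Im (g u)).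

Lemma cmeasurableM g g' : cmeasurable g -> cmeasurable g' ->
  cmeasurable (fun u => g u * g' u).
Proof.
move=> [m1 m2] [m3 m4]; split.
- under eq_fun do rewrite ReM.
  by apply: measurable_funB; exact: measurable_funM.
- under eq_fun do rewrite ImM.
  by apply: measurable_funD; exact: measurable_funM.
Qed.

Lemma cmeasurableD g g' : cmeasurable g -> cmeasurable g' ->
  cmeasurable (fun u => g u + g' u).
Proof.
move=> [m1 m2] [m3 m4]; split.
- by under eq_fun do rewrite raddfD /=; exact: measurable_funD.
- by under eq_fun do rewrite raddfD /=; exact: measurable_funD.
Qed.

Lemma cmeasurable_cst (c : R[i]) : cmeasurable (fun=> c).
Proof. by split. Qed.

Lemma cmeasurable_herm z : cmeasurable (herm z).
Proof. by split; [exact: measurable_Re_herm|exact: measurable_Im_herm]. Qed.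

Lemma cmeasurable_conj g : cmeasurable g -> cmeasurable (fun u => conjc (g u)).
Proof.
move=> [m1 m2]; split.
- by rewrite (_ : (fun _ => _) = fun u => complex.Re (g u))//;
    apply/funext => u; case: (g u).
- rewrite (_ : (fun _ => _) = fun u => - complex.Im (g u)); first exact: measurable_funN.
  by apply/funext => u; case: (g u).
Qed.

Lemma cmeasurable_cexp_herm z : cmeasurable (fun u => cexp (herm z u / 2%:R)).
Proof.
have mRe : measurable_fun setT (fun u => expR (complex.Re (herm z u / 2%:R))).
  under eq_fun do rewrite Re_half.
  apply: (measurableT_comp (@measurable_expR R)); apply: measurable_funM => //.
  exact: measurable_Re_herm.
have mIm : measurable_fun setT (fun u => complex.Im (herm z u / 2%:R)).
  under eq_fun do rewrite Im_half.
  by apply: measurable_funM => //; exact: measurable_Im_herm.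
split.
- under eq_fun do rewrite Re_real /=.
  apply: measurable_funM => //; apply: (measurableT_comp _ mIm).
  exact: continuous_measurable_fun (@continuous_cos R).
- under eq_fun do rewrite Im_real /=.
  apply: measurable_funM => //; apply: (measurableT_comp _ mIm).
  exact: continuous_measurable_fun (@continuous_sin R).
Qed.

(** The Gaussian rate is the growth of [K_N (|u|^2)] uniformly in [N]; arbitrary powers of [weight]
    make the class stable under polynomial multipliers. *)
Definition rapid h : Prop := cmeasurable h /\
  forall k : nat, exists C : R, forall z,
    expR (enorm z ^+ 2 / 2) * normc (h z) <= C * (weight z)^-1 ^+ k.

(** A factor of growth [weight] uses up one power of decay. *)
Lemma rapidM (g : 'rV[R[i]]_n -> R[i]) h (D : R) : cmeasurable g ->
  (forall z, normc (g z) <= D * weight z) -> rapid h ->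
  rapid (fun z => g z * h z).
Proof.
move=> mg gD [mh hC]; split=> [|k]; first exact: cmeasurableM.
have D0 : 0 <= D.
  have := le_trans (normc_ge0 _) (gD 0).
  by rewrite pmulr_lge0// weight_gt0.
have [C CE] := hC k.+1; exists (D * C) => z; rewrite normcM mulrCA.
apply: (le_trans (ler_pM (normc_ge0 _) _ (gD z) (CE z))).
  by rewrite mulr_ge0 ?expR_ge0 ?normc_ge0.
rewrite exprS le_eqVlt; apply/orP; left; apply/eqP.
have w0 := weight_gt0 z; rewrite exprVn.
by field; rewrite ?expf_neq0 ?lt0r_neq0.
Qed.

Lemma rapidZ (c : R[i]) h : rapid h -> rapid (fun z => c * h z).
Proof.
apply: (@rapidM _ _ (normc c)); first exact: cmeasurable_cst.
by move=> z; rewrite ler_peMr ?normc_ge0// weight_ge1.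
Qed.

Lemma normc_herm_le v z : normc (herm v z) <= (enorm v ^+ 2 + 1) * weight z.
Proof.
apply: (le_trans (normc_le_ReIm _)).
apply: (@le_trans _ _ (enorm v ^+ 2 + enorm z ^+ 2)).
  have := Re_herm_le v z; have := Im_herm_le v z.
  by move: (`|_|) (`|_|) (enorm v ^+ 2) (enorm z ^+ 2) => a b c d h1 h2; lra.
have := sqr_ge0 (enorm v); have := sqr_ge0 (enorm z); rewrite /weight.
by move: (enorm v ^+ 2) (enorm z ^+ 2) => a b h1 h2; nra.
Qed.

Lemma normc_conj (x : R[i]) : normc (conjc x) = normc x.
Proof. by case: x => a b /=; rewrite sqrrN. Qed.

Lemma rapid_herm v h : rapid h -> rapid (fun z => herm v z * h z).
Proof. exact: rapidM (cmeasurable_herm v) (normc_herm_le v). Qed.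

Lemma rapid_conj_herm v h : rapid h -> rapid (fun z => conjc (herm v z) * h z).
Proof.
apply: (rapidM (D := enorm v ^+ 2 + 1)) => [|z].
  exact: cmeasurable_conj (cmeasurable_herm v).
by rewrite normc_conj normc_herm_le.
Qed.

Lemma rapidD h h' : rapid h -> rapid h' -> rapid (fun z => h z + h' z).
Proof.
move=> [mh hC] [mh' hC']; split=> [|k]; first exact: cmeasurableD.
have [C CE] := hC k; have [C' CE'] := hC' k; exists (C + C') => z.
rewrite mulrDl; apply: le_trans (lerD (CE z) (CE' z)); rewrite -mulrDr.
by rewrite ler_wpM2l ?expR_ge0// le_normcD.
Qed.

Lemma integrable_weight_bound (g : borelC R n -> R) (C : R) :
  measurable_fun setT g -> (forall u, `|g u| <= C * (weight u)^-1 ^+ (n + n)) ->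
  leb.-integrable setT (EFin \o g).
Proof.
move=> mg gC; have := integrableZl measurableT C (@integrable_weight R n).
apply: le_integrable => //; first exact/measurable_EFinP.
move=> u _; rewrite /= lee_fin (le_trans (gC u))//.
by rewrite normrM; apply: (le_trans (ler_norm _)); rewrite normrM.
Qed.

(** The constant is uniform over [|z|^2 <= Z]: it furnishes the majorant when [z] moves along a
    segment. The factor [a] stands for the value of a kernel. *)
Lemma rapid_bound h (B Z : R) (m k : nat) : rapid h ->
  exists C : R, forall (a : R) z u, enorm z ^+ 2 <= Z -> `|a| <= B * weight u ^+ m ->
    `|a * complex.Re (cexp (herm z u / 2%:R) * h u)| <= C * (weight u)^-1 ^+ k.
Proof.
move=> [mh hC]; have [C CE] := hC (m + k)%N.
exists (B * expR (Z / 4) * C) => a z u zZ aB; have w0 := weight_gt0 u.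
have B0 : 0 <= B * weight u ^+ m := le_trans (normr_ge0 _) aB.
rewrite normrM; apply: (@le_trans _ _ (B * weight u ^+ m *
    (expR (Z / 4) * (C * (weight u)^-1 ^+ (m + k))))).
  apply: ler_pM => //; apply: (le_trans (Re_cexp_herm_le _ _ _)); rewrite -mulrA.
  apply: ler_pM => //.
  - by rewrite mulr_ge0 ?expR_ge0 ?normc_ge0.
  - by rewrite ler_expR ler_pM2r.
rewrite exprD !exprVn le_eqVlt; apply/orP; left; apply/eqP.
by field; rewrite !expf_neq0 ?lt0r_neq0.
Qed.

Lemma rapid_integrable h (K : borelC R n -> R) (B : R) (m : nat) z : rapid h ->
  measurable_fun setT K -> (forall u, `|K u| <= B * weight u ^+ m) ->
  leb.-integrable setT
    (EFin \o (fun u => K u * complex.Re (cexp (herm z u / 2%:R) * h u))).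
Proof.
move=> rh mK KB; have [C CE] := rapid_bound B (enorm z ^+ 2) m (n + n) rh.
apply: (integrable_weight_bound (C := C)) => [|u]; last exact: CE.
apply: measurable_funM => //.
exact: (cmeasurableM (cmeasurable_cexp_herm z) rh.1).1.
Qed.

Lemma kernel_growth b N (A Z : R) : exists (C : R) (m : nat), 0 <= C /\
  forall z u, enorm z ^+ 2 <= Z ->
    `|kernel b N (enorm ((u : 'rV[R[i]]_n) - z) ^+ 2 - A)| <= C * weight u ^+ m.
Proof.
(* From [|u - z|^2 <= 2 |u|^2 + 2 |z|^2], the argument of the kernel is at most [D * weight u] in
   modulus. *)
pose D := 2 + 2 * `|Z| + `|A|.
have D0 : 2 <= D by rewrite /D; have := normr_ge0 Z; have := normr_ge0 A; lra.
exists (2 ^+ b * D ^+ (N + b)), (N + b)%N; split.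
  by rewrite mulr_ge0// exprn_ge0//; lra.
move=> z u zZ; rewrite -mulrA -exprMn; apply: kernel_bound.
  by have := weight_ge1 u; nra.
have e0 := sqr_ge0 (enorm ((u : 'rV[R[i]]_n) - z)).
have : enorm ((u : 'rV[R[i]]_n) - z) ^+ 2 <= 2 * enorm u ^+ 2 + 2 * enorm z ^+ 2.
  have := Re_herm_le z u; rewrite enormB_sqr ler_norml => /andP[].
  by move: (complex.Re _) (enorm u ^+ 2) (enorm z ^+ 2) => a c d h1 h2; lra.
have := le_trans zZ (ler_norm Z); have := sqr_ge0 (enorm u).
rewrite /D /weight; move: (enorm u ^+ 2) (enorm z ^+ 2) (enorm _ ^+ 2) e0 => a c d d0 a0 cZ dac.
have := normr_ge0 A; have := ler_norm A; have := ler_norm (- A); rewrite normrN.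
have := normr_ge0 Z; move: (`|A|) (`|Z|) cZ => A' Z' cZ h1 h2 h3 h4.
by rewrite ler_norml; apply/andP; split; nra.
Qed.

(** Only a real part; the complex integral is recovered by letting [c * h] replace [h], which is why
    [annihilated] quantifies over [c]. *)
Definition moment b N z (A : R) h : R :=
  \int[leb]_u (kernel b N (enorm ((u : 'rV[R[i]]_n) - z) ^+ 2 - A) *
    complex.Re (cexp (herm z u / 2%:R) * h u)).

(** Up to sign, the contribution of the kernel factor when [moment b N.+1] is differentiated in [z]
    along [v]. *)
Definition derived_moment b N z (A : R) v h : R :=
  \int[leb]_u (kernel b N (enorm ((u : 'rV[R[i]]_n) - z) ^+ 2 - A) *
    complex.Re (herm v ((u : 'rV[R[i]]_n) - z)) *
    complex.Re (cexp (herm z u / 2%:R) * h u)).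

Lemma measurable_kernel_enorm b N z (A : R) : measurable_fun setT
  (fun u : borelC R n => kernel b N (enorm ((u : 'rV[R[i]]_n) - z) ^+ 2 - A)).
Proof.
apply: (measurableT_comp (@measurable_kernel R b N)).
by apply: measurable_funB => //; exact: measurable_enormB.
Qed.

Lemma moment_integrable b N z A h : rapid h -> leb.-integrable setT (EFin \o (fun u =>
  kernel b N (enorm ((u : 'rV[R[i]]_n) - z) ^+ 2 - A) *
    complex.Re (cexp (herm z u / 2%:R) * h u))).
Proof.
move=> rh; have [C [m [C0 CE]]] := kernel_growth b N A (enorm z ^+ 2).
apply: (rapid_integrable (B := C) (m := m)) => //.
- exact: measurable_kernel_enorm.
- by move=> u; exact: CE.
Qed.

Lemma Re_hermB_le v z u : `|complex.Re (herm v ((u : 'rV[R[i]]_n) - z))| <=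
  (enorm v ^+ 2 + enorm z ^+ 2 + 1) * weight u.
Proof.
have := Re_herm_le v u; have := Re_herm_le v z.
rewrite hermBr raddfB /= => h1 h2; apply: (le_trans (ler_normB _ _)).
have := sqr_ge0 (enorm u); have := sqr_ge0 (enorm z); have := sqr_ge0 (enorm v).
rewrite /weight; move: (`|_|) (`|_|) (enorm v ^+ 2) (enorm z ^+ 2) (enorm u ^+ 2) h1 h2.
by move=> a b c d e h1 h2 h3 h4 h5; nra.
Qed.

Lemma derived_growth b N (A Z V : R) : exists (C : R) (m : nat), 0 <= C /\
  forall z v u, enorm z ^+ 2 <= Z -> enorm v ^+ 2 <= V ->
    `|kernel b N (enorm ((u : 'rV[R[i]]_n) - z) ^+ 2 - A) *
      complex.Re (herm v ((u : 'rV[R[i]]_n) - z))| <= C * weight u ^+ m.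
Proof.
have [C [m [C0 CE]]] := kernel_growth b N A Z.
exists (C * (`|V| + `|Z| + 1)), m.+1; split; first by rewrite mulr_ge0.
move=> z v u zZ vV; rewrite normrM [weight u ^+ m.+1]exprSr mulrACA.
apply: ler_pM => //; first exact: CE.
apply: (le_trans (Re_hermB_le _ _ _)); rewrite ler_wpM2r ?(ltW (weight_gt0 _))//.
by have := le_trans zZ (ler_norm Z); have := le_trans vV (ler_norm V); lra.
Qed.

Lemma derived_moment_integrable b N z A v h : rapid h ->
  leb.-integrable setT (EFin \o (fun u =>
  kernel b N (enorm ((u : 'rV[R[i]]_n) - z) ^+ 2 - A) *
    complex.Re (herm v ((u : 'rV[R[i]]_n) - z)) *
    complex.Re (cexp (herm z u / 2%:R) * h u))).
Proof.
move=> rh; have [C [m [C0 CE]]] := derived_growth b N A (enorm z ^+ 2) (enorm v ^+ 2).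
apply: (rapid_integrable (B := C) (m := m)) => //.
- apply: measurable_funM; first exact: measurable_kernel_enorm.
  under eq_fun do rewrite hermBr raddfB /=.
  by apply: measurable_funB => //; exact: measurable_Re_herm.
- by move=> u; exact: CE.
Qed.

Lemma is_derive_cexp (a b y : R[i]) (t : R) :
  is_derive t 1 (fun t : R => complex.Re (cexp (a + t%:C * b) * y))
    (complex.Re (cexp (a + t%:C * b) * (b * y))).
Proof.
have lin (c d : R) : is_derive t 1 (fun t : R => c + t * d) d.
  apply: (is_derive_quadratic_remainder (C := 0)) => k.
  by rewrite mul0r mulrDl normr_le0; apply/eqP; ring.
have dE := is_derive1_comp (is_derive_expR _) (lin (complex.Re a) (complex.Re b)).
have dC := is_derive1_comp (is_derive_cos _) (lin (complex.Im a) (complex.Im b)).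
have dS := is_derive1_comp (is_derive_sin _) (lin (complex.Im a) (complex.Im b)).
have dCS := is_deriveB (is_deriveZ (complex.Re y) dC) (is_deriveZ (complex.Im y) dS).
have d := is_deriveM dE dCS.
rewrite (_ : (fun t : R => _) = (expR \o (fun t => complex.Re a + t * complex.Re b)) *
  (complex.Re y *: (cos \o (fun t => complex.Im a + t * complex.Im b)) -
   complex.Im y *: (sin \o (fun t => complex.Im a + t * complex.Im b)))); last first.
  apply/funext => s; rewrite ReM Re_real Im_real /= !raddfD /= Re_real Im_real.
  rewrite [RHS](_ : _ = expR (complex.Re a + s * complex.Re b) *
    (complex.Re y * cos (complex.Im a + s * complex.Im b) -
     complex.Im y * sin (complex.Im a + s * complex.Im b)))//.
  ring.
apply: (is_derive_eq d); rewrite /GRing.scale /= !fctE /=.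
rewrite ReM Re_real Im_real /= !raddfD /= Re_real Im_real ReM ImM.
have sE (p q : R) : p *: (q : R^o) = p * q by [].
by rewrite !sE; ring.
Qed.

Lemma is_derive_moment_integrand b N z v u (A : R) (y : R[i]) (t : R) : (0 < N)%N ->
  is_derive t 1 (fun t : R =>
    kernel b N.+1 (enorm ((u : 'rV[R[i]]_n) - (z + t%:C *: v)) ^+ 2 - A) *
    complex.Re (cexp (herm (z + t%:C *: v) u / 2%:R) * y))
   (kernel b N.+1 (enorm ((u : 'rV[R[i]]_n) - (z + t%:C *: v)) ^+ 2 - A) *
      complex.Re (cexp (herm (z + t%:C *: v) u / 2%:R) * (herm v u / 2%:R * y)) -
    kernel b N (enorm ((u : 'rV[R[i]]_n) - (z + t%:C *: v)) ^+ 2 - A) *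
      complex.Re (herm v ((u : 'rV[R[i]]_n) - (z + t%:C *: v))) *
      complex.Re (cexp (herm (z + t%:C *: v) u / 2%:R) * y)).
Proof.
move=> N0.
have hermt (s : R) : herm (z + s%:C *: v) u / 2%:R =
    herm z u / 2%:R + s%:C * (herm v u / 2%:R).
  rewrite hermDl mulrDl mulrA; congr (_ + _ / _).
  by rewrite hermZl; congr (_ * _); apply/eqP; rewrite eq_complex /= oppr0 !eqxx.
have dist (s : R) : enorm ((u : 'rV[R[i]]_n) - (z + s%:C *: v)) ^+ 2 - A =
    enorm ((u : 'rV[R[i]]_n) - z) ^+ 2 - A -
    s * (2 * complex.Re (herm v ((u : 'rV[R[i]]_n) - z))) + s ^+ 2 * enorm v ^+ 2.
  by rewrite opprD addrA enormBZ_sqr; ring.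
(* The squared distance is a quadratic polynomial in [s], with remainder exactly [|v|^2 k^2]. *)
have dq : is_derive t 1
    (fun s : R => enorm ((u : 'rV[R[i]]_n) - (z + s%:C *: v)) ^+ 2 - A)
    (- (2 * complex.Re (herm v ((u : 'rV[R[i]]_n) - (z + t%:C *: v))))).
  have -> : complex.Re (herm v ((u : 'rV[R[i]]_n) - (z + t%:C *: v))) =
      complex.Re (herm v ((u : 'rV[R[i]]_n) - z)) - t * enorm v ^+ 2.
    (* Expanding [|v - v|^2 = 0] gives [Re (herm v v) = |v|^2]. *)
    have e2 := enormB_sqr v v; have : enorm (v - v) ^+ 2 = 0.
      by rewrite subrr enorm_sqr big1// => j _; rewrite mxE expr0n addr0.
    rewrite e2 => e0.
    have -> : (u : 'rV_n) - (z + t%:C *: v) = (u : 'rV_n) - z - t%:C *: v.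
      by rewrite opprD addrA.
    rewrite [in LHS]hermBr.
    have -> : herm v (t%:C *: v) = t%:C * herm v v.
      by rewrite /herm mulr_sumr; apply: eq_bigr => j _; rewrite mxE mulrCA.
    by rewrite raddfB /= Re_real; congr (_ - _ * _); lra.
  rewrite (funext dist); have := sqr_ge0 (enorm v).
  move: (enorm _ ^+ 2 - A) (complex.Re _) (enorm v ^+ 2) => p q e e0.
  apply: (is_derive_quadratic_remainder (C := e)) => k.
  rewrite [X in `|X|](_ : _ = e * k ^+ 2); last by ring.
  by rewrite ger0_norm// mulr_ge0// sqr_ge0.
have dK := is_derive1_comp (is_derive_kernel b _ N0) dq.
have dE := is_derive_cexp (herm z u / 2%:R) (herm v u / 2%:R) y t.
have d := is_deriveM dK dE.
rewrite (_ : (fun s : R => _) = (kernel b N.+1 \o (fun s : R =>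
    enorm ((u : 'rV[R[i]]_n) - (z + s%:C *: v)) ^+ 2 - A)) *
  (fun s : R => complex.Re (cexp (herm z u / 2%:R + s%:C * (herm v u / 2%:R)) * y))); last first.
  by apply/funext => s; rewrite hermt.
apply: (is_derive_eq d); rewrite /GRing.scale /= -hermt.
move: (kernel b N.+1 _) (kernel b N _) (complex.Re _) (complex.Re (cexp _ * y)).
by move=> k1 k0 e1 e0; field.
Qed.

End rapidly_decaying_functions.

(** * Differentiation in [z] and multiplication by linear forms *)

Section vanishing_moments.
Context {R : realType} (n : nat).
Local Open Scope complex_scope.
Local Notation leb := (@lebesgueC R n).
Implicit Types (z v : 'rV[R[i]]_n) (h : 'rV[R[i]]_n -> R[i]) (u : borelC R n).

(** The moment vanishes along a segment, so its derivative at [t = 0] is 0; by the product rule this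
    derivative is the difference of the two sides. *)
Lemma moment_derivative b N z (A : R) v h (d : R) : (0 < N)%N -> rapid h -> 0 < d ->
  (forall t, `|t| < d -> moment b N.+1 (z + t%:C *: v) A h = 0) ->
  derived_moment b N z A v h = moment b N.+1 z A (fun u => herm v u / 2%:R * h u).
Proof.
move=> N0 rh d0 m0.
have rvh : rapid (fun u => herm v u / 2%:R * h u).
  rewrite (_ : (fun u => _) = fun u => (2%:R)^-1 * (herm v u * h u)); last first.
    by apply/funext => u; rewrite mulrAC mulrC.
  by apply: rapidZ; exact: rapid_herm.
(* [|t| < 1] is needed for the bound [Z] on [|z + t v|^2]. *)
pose e := Num.min d 1; have e0 : 0 < e by rewrite lt_min d0 ltr01.
pose f (t : R) u := kernel b N.+1 (enorm ((u : 'rV[R[i]]_n) - (z + t%:C *: v)) ^+ 2 - A) *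
  complex.Re (cexp (herm (z + t%:C *: v) u / 2%:R) * h u).
pose D (t : R) u :=
  kernel b N.+1 (enorm ((u : 'rV[R[i]]_n) - (z + t%:C *: v)) ^+ 2 - A) *
    complex.Re (cexp (herm (z + t%:C *: v) u / 2%:R) * (herm v u / 2%:R * h u)) -
  kernel b N (enorm ((u : 'rV[R[i]]_n) - (z + t%:C *: v)) ^+ 2 - A) *
    complex.Re (herm v ((u : 'rV[R[i]]_n) - (z + t%:C *: v))) *
    complex.Re (cexp (herm (z + t%:C *: v) u / 2%:R) * h u).
have df (t : R) u : is_derive t (1 : R) (f ^~ u) (D t u) by exact: is_derive_moment_integrand.
pose Z := 2 * enorm z ^+ 2 + 2 * enorm v ^+ 2.
have zZ (t : R) : `|t| < e -> enorm (z + t%:C *: v) ^+ 2 <= Z.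
  move=> te; have t1 : `|t| <= 1.
    by apply: ltW; apply: (lt_le_trans te); rewrite ge_min lexx orbT.
  have t21 : t ^+ 2 <= 1 by rewrite -real_normK ?num_real// expr_le1.
  have -> : z + t%:C *: v = z - (- t%:C) *: v by rewrite scaleNr opprK.
  rewrite -rmorphN enormBZ_sqr sqrrN /Z.
  have := Re_herm_le v z; have := sqr_ge0 (enorm v); have := sqr_ge0 (enorm z).
  move: (complex.Re _) (enorm v ^+ 2) (enorm z ^+ 2) => a p q q0 p0.
  move: t1; rewrite !ler_norml => /andP[t1 t2] /andP[h1 h2].
  by nra.
have [C1 [m1 [C10 C1E]]] := @kernel_growth R n b N.+1 A Z.
have [C2 [m2 [C20 C2E]]] := @derived_growth R n b N A Z (enorm v ^+ 2).
have [B1 B1E] := rapid_bound C1 Z m1 (n + n) rvh.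
have [B2 B2E] := rapid_bound C2 Z m2 (n + n) rh.
pose G u := (`|B1| + `|B2|) * (weight (u : 'rV[R[i]]_n))^-1 ^+ (n + n).
have G0 u : 0 <= G u.
  by rewrite mulr_ge0 ?addr_ge0// exprn_ge0// invr_ge0 ltW// weight_gt0.
have intG : leb.-integrable setT (EFin \o G).
  apply: (integrable_weight_bound (C := `|B1| + `|B2|)) => [|u]; last first.
    by rewrite ger0_norm.
  apply: measurable_funM => //; apply: measurable_funX.
  exact: (measurableT_comp measurable_invr (@measurable_weight R n)).
have DG (t : R) u : `|t| < e -> `|D t u| <= G u.
  move=> te; apply: (le_trans (ler_normB _ _)); rewrite /G mulrDl.
  have w0 : 0 <= (weight (u : 'rV[R[i]]_n))^-1 ^+ (n + n).
    by rewrite exprn_ge0// invr_ge0 ltW// weight_gt0.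
  apply: lerD.
    apply: (le_trans (B1E _ _ _ (zZ _ te) (C1E _ _ (zZ _ te)))).
    by rewrite ler_wpM2r// ler_norm.
  apply: (le_trans (B2E _ _ _ (zZ _ te) (C2E _ _ _ (zZ _ te) (lexx _)))).
  by rewrite ler_wpM2r// ler_norm.
have fz (t : R) : `|t| < d -> \int[leb]_u f t u = 0 by exact: m0.
have int_f (t : R) : leb.-integrable setT (EFin \o f t) by exact: moment_integrable.
have I0 : `]- e, e[%classic (0 : R) by rewrite /= in_itv /= oppr_lt0 e0.
have Ie (t : R) : `]- e, e[%classic t -> `|t| < e.
  by rewrite /= in_itv /= ltr_norml.
have d1f (t : R) u : partial1of2 f t u = D t u.
  by rewrite partial1of2E; have [_ ->] := df t u.
have Gub (t : R) u : `]- e, e[%classic t -> setT u -> `|partial1of2 f t u| <= G u.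
  by move=> It _; rewrite d1f; exact: DG (Ie _ It).
have lim := @cvg_differentiation_under_integral R _ _ leb f setT measurableT 0 (- e) e
  I0 (fun t _ => int_f t) (fun t u _ _ => @ex_derive _ _ _ _ _ _ _ (df t u)) G G0 intG Gub.
(* Near 0 the difference quotient is identically 0. *)
have lim0 : (k^-1 *: (\int[leb]_u f (k + 0) u - \int[leb]_u f 0 u)) @[k --> 0^'] --> (0 : R).
  apply: cvg_near_cst; near=> k.
  have ke : `|k| < d.
    by near: k; exact: dnbhs0_lt.
  transitivity (k^-1 *: (0 - 0 : R)); last by rewrite subrr scaler0.
  by congr (_ *: (_ - _)); apply: fz; rewrite ?addr0 ?normr0.
have : \int[leb]_u partial1of2 f 0 u = 0 by exact: (cvg_unique _ lim lim0).
have -> : partial1of2 f 0 = D 0 by apply/funext => u; exact: d1f.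
rewrite /D !scale0r addr0 RintegralB//; last 2 first.
- exact: moment_integrable.
- exact: derived_moment_integrable.
by move=> /eqP; rewrite subr_eq0 => /eqP.
Unshelve. all: by end_near. Qed.

Lemma moment_scale b N z A h (c : R) : rapid h ->
  moment b N z A (fun u => c%:C * h u) = c * moment b N z A h.
Proof.
move=> rh; rewrite /moment -RintegralZl//; last exact: moment_integrable.
by apply: eq_Rintegral => u _; rewrite mulrCA Re_real mulrCA.
Qed.

Lemma momentD b N z A h h' : rapid h -> rapid h' ->
  moment b N z A (fun u => h u + h' u) = moment b N z A h + moment b N z A h'.
Proof.
move=> rh rh'; rewrite /moment -RintegralD//; try exact: moment_integrable.
by apply: eq_Rintegral => u _; rewrite mulrDr raddfD /= mulrDr.
Qed.

Lemma momentS b N z A h : rapid h ->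
  moment b.+1 N z A h = moment b N.+1 z A h - moment b N z A h.
Proof.
move=> rh; rewrite /moment -RintegralB//; try exact: moment_integrable.
by apply: eq_Rintegral => u _; rewrite /= mulrBl.
Qed.

(** [z] is kept free, under a condition open in [z], so that the property can be differentiated;
    [N = 0] is excluded because [K_0] has no cut-off. *)
Definition annihilated (r : R) b h : Prop := forall z (A : R) (N : nat) (c : R[i]),
  (r + enorm z) ^+ 2 < A -> (0 < N)%N -> moment b N z A (fun u => c * h u) = 0.

Lemma annihilatedS r b h : rapid h -> annihilated r b h -> annihilated r b.+1 h.
Proof.
by move=> rh ah z A N c rA N0; rewrite momentS ?ah ?subrr//; exact: rapidZ.
Qed.

Lemma annihilatedZ r b h (c : R[i]) : annihilated r b h ->
  annihilated r b (fun u => c * h u).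
Proof.
move=> ah z A N c' rA N0; rewrite -[RHS](ah z A N (c' * c) rA N0).
by congr moment; apply/funext => u; rewrite mulrA.
Qed.

Lemma annihilatedD r b h h' : rapid h -> rapid h' -> annihilated r b h ->
  annihilated r b h' -> annihilated r b (fun u => h u + h' u).
Proof.
move=> rh rh' ah ah' z A N c rA N0.
rewrite (_ : (fun u => _) = fun u => c * h u + c * h' u); last first.
  by apply/funext => u; rewrite mulrDr.
by rewrite momentD ?ah ?ah' ?addr0//; exact: rapidZ.
Qed.

Lemma annihilated_derivative r b h v z (A : R) (N : nat) (c : R[i]) : 0 <= r ->
  rapid h -> annihilated r b h -> (r + enorm z) ^+ 2 < A -> (0 < N)%N ->
  2 * derived_moment b N z A v (fun u => c * h u) =
  moment b N.+1 z A (fun u => c * (herm v u * h u)).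
Proof.
move=> r0 rh ah rA N0; have rch := rapidZ c rh.
(* The strict inequality survives small displacements of [z], by continuity of [enorm]. *)
have [d d0 dA] : exists2 d : R, 0 < d &
    forall t, `|t| < d -> (r + enorm (z + t%:C *: v)) ^+ 2 < A.
  have cg : (r + enorm (z + t%:C *: v)) ^+ 2 @[t --> (0 : R)] --> (r + enorm z) ^+ 2.
    have -> : (fun t : R => (r + enorm (z + t%:C *: v)) ^+ 2) =
        fun t : R => (r + enorm (z + t%:C *: v)) * (r + enorm (z + t%:C *: v)).
      by apply/funext => t; rewrite expr2.
    have ce : (enorm (z + t%:C *: v)) @[t --> (0 : R)] --> enorm z.
      apply: (cvg_comp (fun t : R => z + t%:C *: v) (@enorm R n) (G := nbhs z)).
        have {2}-> : z = z + (0 : R)%:C *: v by rewrite scale0r addr0.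
        apply: (@cvgD _ _ _ (nbhs (0 : R))); first exact: cvg_cst.
        apply: (@cvgZ _ _ _ (nbhs (0 : R))); last exact: cvg_cst.
        exact: continuous_real_complex.
      exact: continuous_enorm.
    by apply: cvgM; (apply: cvgD; [exact: cvg_cst|exact: ce]).
  have /nbhs_ballP[d /= d0 dB] : \forall t \near (0 : R), (r + enorm (z + t%:C *: v)) ^+ 2 < A.
    exact: (cvgr_lt _ cg).
  by exists d => // t td; apply: dB; rewrite /ball /= sub0r normrN.
have := @moment_derivative b N z A v _ d N0 rch d0.
move=> ->; last by move=> t td; apply: ah => //; exact: dA.
rewrite -moment_scale; last first.
  rewrite (_ : (fun u => _) = fun u => (2%:R)^-1 * (herm v u * (c * h u))); last first.
    by apply/funext => u; rewrite mulrAC mulrC.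
  by apply: rapidZ; exact: rapid_herm.
congr moment; apply/funext => u.
have -> : (2 : R)%:C = 2%:R :> R[i] by rewrite rmorph_nat.
have two0 : (2%:R : R[i]) != 0 by rewrite pnatr_eq0.
by field.
Qed.

(* Put [M v := derived_moment b N z A v (c h)], where [Re (conj v . (u - z))] is
   integrated. Then [M v + M (i v)], with [c] replaced by [i c] in the second term,
   is the moment of [conj v . (u - z)], [M v - M (i v)] that of its conjugate, and
   both terms equal half the moment of [conj v . u] at index [N + 1]. *)
Lemma annihilated_herm r b h v : 0 <= r -> rapid h -> annihilated r b h ->
  annihilated r b.+1 (fun u => herm v u * h u) /\
  annihilated r b (fun u => conjc (herm v u) * h u).
Proof.
move=> r0 rh ah.
suff main z A N c : (r + enorm z) ^+ 2 < A -> (0 < N)%N ->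
    moment b N z A (fun u => c * (herm v u * h u)) =
      moment b N.+1 z A (fun u => c * (herm v u * h u)) /\
    moment b N z A (fun u => c * (conjc (herm v u) * h u)) = 0.
  split=> z A N c rA N0; last exact: (main _ _ _ _ rA N0).2.
  rewrite momentS; last by apply: rapidZ; exact: rapid_herm.
  by rewrite -(main _ _ _ _ rA N0).1 subrr.
move=> rA N0.
pose iv := (0 +i* 1) *: v.
have D1 := annihilated_derivative v c r0 rh ah rA N0.
have D2 := annihilated_derivative iv (c * (0 +i* 1)) r0 rh ah rA N0.
have rch := rapidZ c rh; have rich := rapidZ (c * (0 +i* 1)) rh.
have rvh := rapidZ c (rapid_herm v rh).
have rcvh := rapidZ c (rapid_conj_herm v rh).
have hermi u : herm iv u = - (0 +i* 1) * herm v u.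
  rewrite hermZl; congr (_ * _); apply/eqP; rewrite eq_complex /= oppr0 !eqxx//.
have icM (x : R[i]) : c * (0 +i* 1) * (- (0 +i* 1) * x) = c * x.
  rewrite mulrA; congr (_ * _); rewrite -mulrA mulrN.
  have -> : (0 +i* 1) * (0 +i* 1) = -1 :> R[i].
    by apply/eqP; rewrite eq_complex /= !mul0r !mulr1 mulr0 sub0r addr0 oppr0 !eqxx.
  by rewrite opprK mulr1.
(* The form is antilinear in [v], so [conj i = - i] cancels the factor [i] of [c * i]: both
   derivatives have the same right-hand side. *)
have DD : moment b N.+1 z A (fun u => c * (0 +i* 1) * (herm iv u * h u)) =
    moment b N.+1 z A (fun u => c * (herm v u * h u)).
  by congr moment; apply/funext => u; rewrite hermi -[_ * herm v u * h u]mulrA icM.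
have Reic (x : R[i]) : complex.Re ((0 +i* 1) * x) = - complex.Im x.
  by rewrite ReM /=; ring.
have split1 : moment b N z A (fun u => c * (herm v ((u : 'rV[R[i]]_n) - z) * h u)) =
    derived_moment b N z A v (fun u => c * h u) +
    derived_moment b N z A iv (fun u => c * (0 +i* 1) * h u).
  rewrite /derived_moment -RintegralD//; try exact: derived_moment_integrable.
  apply: eq_Rintegral => u _; rewrite Re_hermi.
  have -> : cexp (herm z u / 2%:R) * (c * (0 +i* 1) * h u) =
      (0 +i* 1) * (cexp (herm z u / 2%:R) * (c * h u)) by ring.
  rewrite Reic.
  have -> : cexp (herm z u / 2%:R) * (c * (herm v ((u : 'rV__) - z) * h u)) =
      herm v ((u : 'rV__) - z) * (cexp (herm z u / 2%:R) * (c * h u)) by ring.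
  rewrite ReM; move: (kernel _ _ _) (complex.Re _) (complex.Re (cexp _ * _)) => k0 a p.
  by move: (complex.Im _) (complex.Im (cexp _ * _)) => a' p'; ring.
have split2 : moment b N z A (fun u => c * (conjc (herm v ((u : 'rV[R[i]]_n) - z)) * h u)) =
    derived_moment b N z A v (fun u => c * h u) -
    derived_moment b N z A iv (fun u => c * (0 +i* 1) * h u).
  rewrite /derived_moment -RintegralB//; try exact: derived_moment_integrable.
  apply: eq_Rintegral => u _; rewrite Re_hermi.
  have -> : cexp (herm z u / 2%:R) * (c * (0 +i* 1) * h u) =
      (0 +i* 1) * (cexp (herm z u / 2%:R) * (c * h u)) by ring.
  rewrite Reic.
  have -> : cexp (herm z u / 2%:R) * (c * (conjc (herm v ((u : 'rV__) - z)) * h u)) =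
      conjc (herm v ((u : 'rV__) - z)) * (cexp (herm z u / 2%:R) * (c * h u)) by ring.
  rewrite ReM; move: (kernel _ _ _) (complex.Re (cexp _ * _)) => k0 p.
  by move: (complex.Im (cexp _ * _)) => p'; case: (herm v _) => x y /=; ring.
have two (x y : R) : 2 * x = y -> x = y / 2 by move=> <-; field.
rewrite DD in D2; move/two: D1 => D1; move/two: D2 => D2.
move: split1 split2; rewrite D1 D2 subrr => split1 split2; split.
- rewrite [RHS](_ : _ = moment b N.+1 z A (fun u => c * (herm v u * h u)) / 2 +
    moment b N.+1 z A (fun u => c * (herm v u * h u)) / 2); last by field.
  rewrite -split1.
  (* [conj v . z] does not depend on [u]: replacing [u - z] by [u] changes the integral by a moment
     of [h], which is 0. *)
  rewrite (_ : (fun u => c * (herm v (u - z) * h u)) =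
      fun u => c * (herm v u * h u) + (- (c * herm v z)) * h u); last first.
    by apply/funext => u; rewrite hermBr; ring.
  by rewrite momentD//; [rewrite ah// addr0|exact: rapidZ].
- rewrite -split2.
  rewrite (_ : (fun u => c * (conjc (herm v (u - z)) * h u)) =
      fun u => c * (conjc (herm v u) * h u) + (- (c * conjc (herm v z))) * h u); last first.
    by apply/funext => u; rewrite hermBr rmorphB /=; ring.
  by rewrite momentD//; [rewrite ah// addr0|exact: rapidZ].
Qed.

End vanishing_moments.

(** * The limit [N -> oo] at [z = 0] *)

Section moments_at_the_origin.
Context {R : realType} (n : nat).
Local Open Scope complex_scope.
Local Notation leb := (@lebesgueC R n).
Implicit Types (z v : 'rV[R[i]]_n) (h : 'rV[R[i]]_n -> R[i]) (u : borelC R n).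

Lemma enorm0 : enorm (0 : 'rV[R[i]]_n) = 0.
Proof. by have := @enormZ R n 0 0; rewrite scale0r normr0 mul0r. Qed.

Lemma cexp_herm0 u : cexp (herm 0 u / 2%:R) = 1.
Proof. by rewrite herm0l mul0r cexp0. Qed.

(** Dominated convergence: at [z = 0] the exponential factor is 1, and for [A >= 0] the kernel is at
    most [exp (|u|^2 / 2)] for all [N]. For [b > 0] the sequence is a difference of two null
    sequences. *)
Lemma cvg_moment b (A : R) h : 0 <= A -> rapid h ->
  moment b N 0 A h @[N --> \oo] --> (0 : R).
Proof.
move=> A0 rh; elim: b => [|b IHb]; last first.
  under eq_fun do rewrite momentS//.
  have shifted : moment b N.+1 0 A h @[N --> \oo] --> (0 : R).
    by rewrite (@cvg_shiftS _ (fun N => moment b N 0 A h)).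
  by have := cvgB shifted IHb; rewrite subrr; apply.
(* The exponential bound is stated for positive indices. *)
rewrite -(@cvg_shiftS _ (fun N => moment 0 N 0 A h)).
have [mh hC] := rh; have [C CE] := hC (n + n)%N.
pose f N u := (truncated_power N.+1 (enorm ((u : 'rV[R[i]]_n) - 0) ^+ 2 - A) *
    complex.Re (cexp (herm 0 u / 2%:R) * h u))%:E.
pose G u := (C * (weight (u : 'rV[R[i]]_n))^-1 ^+ (n + n))%:E.
have [] := @dominated_convergence _ _ _ leb setT measurableT f (cst 0%E) G.
- move=> N; apply/measurable_EFinP; apply: measurable_funM.
    exact: (measurable_kernel_enorm 0 N.+1 0 A).
  exact: (cmeasurableM (cmeasurable_cexp_herm 0) mh).1.
- exact: measurable_cst.
- apply: aeW => u _; apply: cvg_EFin; first exact: nearW.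
  rewrite -[X in _ --> X](mul0r (complex.Re (cexp (herm 0 u / 2%:R) * h u))).
  apply: cvgM; last exact: cvg_cst.
  rewrite (@cvg_shiftS _ (fun N => truncated_power N (enorm ((u : 'rV[R[i]]_n) - 0) ^+ 2 - A))).
  exact: cvg_truncated_power.
- by have := integrableZl measurableT C (@integrable_weight R n).
- apply: aeW => u N _; rewrite /f /G abse_EFin lee_fin; apply: le_trans (CE u).
  rewrite normrM ger0_norm ?truncated_power_ge0// cexp_herm0 mul1r subr0.
  apply: ler_pM; rewrite ?truncated_power_ge0// ?normc_Re//.
  apply: (le_trans (truncated_power_le_expR _ _)); rewrite ler_expR ler_pM2r//.
  by rewrite ge_max sqr_ge0 andbT lerBlDr lerDl.
move=> _ _; rewrite integral0 => lim.
rewrite /moment /Rintegral; apply: (@fine_cvg _ _ _ _ _ 0).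
exact: lim.
Qed.

(* [moment b] vanishes for all [N >= 1], so [moment b.-1] is constant in [N],
   and its limit is 0; descend on [b]. *)
Lemma annihilated_moment0 r b h (A : R) N : rapid h -> annihilated r b h ->
  r ^+ 2 < A -> (0 < N)%N -> moment 0 N 0 A h = 0.
Proof.
move=> rh ah rA; have A0 : 0 <= A by apply: ltW; apply: le_lt_trans rA; exact: sqr_ge0.
have : forall N, (0 < N)%N -> moment b N 0 A h = 0.
  move=> N' N'0; have := ah 0 A N' 1; rewrite enorm0 addr0 => /(_ rA N'0) <-.
  by congr moment; apply/funext => u; rewrite mul1r.
clear ah; elim: b N => [|b IHb] N mb N0; first exact: mb.
apply: IHb => // {N0}N N0.
have step k : moment b (N + k) 0 A h = moment b N 0 A h.
  elim: k => [|k IHk]; first by rewrite addn0.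
  have := mb (N + k)%N; rewrite addn_gt0 N0 => /(_ isT).
  by rewrite momentS// => /eqP; rewrite subr_eq0 -addnS => /eqP ->.
have : moment b (k + N) 0 A h @[k --> \oo] --> (0 : R).
  by rewrite (@cvg_shiftn N _ (fun k => moment b k 0 A h)); exact: cvg_moment.
rewrite (_ : (fun k => _) = cst (moment b N 0 A h)); last first.
  by apply/funext => k; rewrite addnC step.
by move=> /(cvg_unique (@norm_hausdorff _ _) (cvg_cst _)).
Qed.

End moments_at_the_origin.

(** * From twisted means to moments *)

Section twisted_means.
Context {R : realType} (n : nat).
Local Open Scope complex_scope.
Local Notation leb := (@lebesgueC R n).
Implicit Types (z v : 'rV[R[i]]_n) (u : borelC R n).

(** The affine substitution with [c = -1], applied to the positive and negative parts separately, so
    [g] need only be measurable. *)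
Lemma Rintegral_reflection (g : borelC R n -> R) z : measurable_fun setT g ->
  \int[leb]_w g (z - (w : 'rV[R[i]]_n)) = \int[leb]_u g u.
Proof.
move=> mg.
have refl (k : borelC R n -> \bar R) : measurable_fun setT k -> (forall x, 0 <= k x)%E ->
    (\int[leb]_w k (z - (w : 'rV[R[i]]_n))%R = \int[leb]_u k u)%E.
  move=> mk k0; have m1 : (- 1 : R) != 0 by rewrite oppr_eq0 oner_eq0.
  have := ge0_integral_lebesgueC_affine z m1 mk k0.
  rewrite normrN1 invr1 expr1n mul1e => <-; apply: eq_integral => w _; congr k.
  by rewrite rmorphN rmorph1 scaleN1r addrC.
rewrite /Rintegral integralE [in RHS]integralE; congr (fine (_ - _)).
- transitivity (\int[leb]_w ((EFin \o g)^\+ (z - (w : 'rV[R[i]]_n))%R))%E.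
    by apply: eq_integral => w _; rewrite !funeposE.
  apply: refl => //; apply: measurable_funepos; exact/measurable_EFinP.
- transitivity (\int[leb]_w ((EFin \o g)^\- (z - (w : 'rV[R[i]]_n))%R))%E.
    by apply: eq_integral => w _; rewrite !funenegE.
  apply: refl => //; apply: measurable_funeneg; exact/measurable_EFinP.
Qed.

Definition gauss_twist (f : 'rV[R[i]]_n -> R[i]) (u : 'rV[R[i]]_n) : R[i] :=
  (expR (- (enorm u ^+ 2 / 4)))%:C * f u.

Definition twisted_integrand (f : 'rV[R[i]]_n -> R[i]) z (w : borelC R n) : R[i] :=
  f (z - (w : 'rV[R[i]]_n)) *
  expi (complex.Im (\sum_j z 0 j * ((w : 'rV[R[i]]_n) 0 j)^*) / 2).

(* On [|u - z| = s] the twist [e^{-(i/2) Im (z . conj u)}] equals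
   [e^{(conj z . u) / 2}] times [e^{-|u|^2 / 4}] times a function of [s] and [z]. *)
Lemma twisted_integrandE f z u (k : R) (c : R[i]) :
  k * complex.Re (cexp (herm z u / 2%:R) * (c * gauss_twist f u)) =
  k * expR (- ((enorm ((u : 'rV[R[i]]_n) - z) ^+ 2 - enorm z ^+ 2) / 4)) *
    complex.Re (c * twisted_integrand f z (z - (u : 'rV[R[i]]_n))).
Proof.
rewrite -mulrA; congr (_ * _); rewrite -Re_real /twisted_integrand subKr.
(* [z . conj z] is real, and [- Im (z . conj u) = Im (conj z . u)]. *)
have -> : complex.Im (\sum_j z 0 j * ((z - (u : 'rV[R[i]]_n)) 0 j)^*) =
    complex.Im (herm z u).
  rewrite /herm !raddf_sum; apply: eq_bigr => j _; rewrite !mxE.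
  by case: (z 0 j) ((u : 'rV__) 0 j) => [a b] [a' b'] /=; ring.
rewrite enormB_sqr /cexp /gauss_twist Re_half Im_half.
have -> : - ((enorm (u : 'rV[R[i]]_n) ^+ 2 + enorm z ^+ 2 - 2 * complex.Re (herm z u) -
    enorm z ^+ 2) / 4) = complex.Re (herm z u) / 2 + - (enorm (u : 'rV[R[i]]_n) ^+ 2 / 4).
  by field.
rewrite expRD rmorphM /=; congr complex.Re.
move: (expR _)%:C (expR _)%:C (expi _) (f _) => a b p q; ring.
Qed.

Variable f : 'rV[R[i]]_n -> R[i].
Hypothesis cf : continuous f.
Hypothesis decay : forall k : nat, exists C : R, forall z : 'rV[R[i]]_n,
  enorm z ^+ k * expR (4^-1 * enorm z ^+ 2) * normc (f z) <= C.

Lemma cmeasurable_continuous : cmeasurable f.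
Proof.
split; apply: continuous_measurable_borelC => z.
- by apply: (@continuous_comp _ _ _ f (@complex.Re R)); [exact: cf|exact: continuous_Re].
- by apply: (@continuous_comp _ _ _ f (@complex.Im R)); [exact: cf|exact: continuous_Im].
Qed.

Lemma decay_bounded : exists B : R, forall z, normc (f z) <= B.
Proof.
have [C CE] := decay 0; exists C => z; apply: le_trans (CE z).
rewrite expr0 mul1r ler_peMl ?normc_ge0// -expR0 ler_expR.
by rewrite mulr_ge0// ?invr_ge0// sqr_ge0.
Qed.

Lemma rapid_gauss_twist : rapid (gauss_twist f).
Proof.
split=> [|k].
  apply: cmeasurableM; last exact: cmeasurable_continuous.
  split => //=; apply: (measurableT_comp (@measurable_expR R)).
  apply: measurable_funN; apply: measurable_funM => //; apply: measurable_funX.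
  exact: measurable_enorm.
(* Orders 0 and [2k] suffice, because [(1 + x)^k <= 2^k (1 + x^k)] for [x = |z|^2]. *)
have [C0 C0E] := decay 0; have [C CE] := decay k.*2.
exists (2 ^+ k * (C0 + C)) => z; have w0 := weight_gt0 z.
rewrite exprVn ler_pdivlMr ?exprn_gt0//.
have -> : expR (enorm z ^+ 2 / 2) * normc (gauss_twist f z) =
    expR (4^-1 * enorm z ^+ 2) * normc (f z).
  rewrite /gauss_twist normcM /= expr0n addr0 sqrtr_sqr ger0_norm ?expR_ge0//.
  by rewrite mulrA -expRD; congr (expR _ * _); field.
have := C0E z; have := CE z; rewrite expr0 mul1r -mul2n exprM -[X in X <= _]mulrA.
have := mulr_ge0 (expR_ge0 (4^-1 * enorm z ^+ 2)) (normc_ge0 (f z)).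
move: (expR _ * normc _) => p p0 h1 h2.
have x0 := sqr_ge0 (enorm z); rewrite /weight; move: (enorm z ^+ 2) x0 h1 => x x0 h1.
apply: (@le_trans _ _ (p * (2 ^+ k * (1 + x ^+ k)))).
  rewrite ler_wpM2l//; have [x1|x1] := leP x 1.
    apply: (@le_trans _ _ (2 ^+ k)); first by rewrite lerXn2r ?nnegrE//; lra.
    by rewrite ler_peMr ?exprn_ge0// lerDl exprn_ge0.
  apply: (@le_trans _ _ (2 ^+ k * x ^+ k)); last first.
    by rewrite ler_wpM2l ?exprn_ge0// lerDr.
  by rewrite -exprMn lerXn2r ?nnegrE//; lra.
rewrite mulrCA ler_wpM2l ?exprn_ge0// mulrDr mulr1 lerD// mulrC//.
Qed.

(** The substitution [u = z - w] turns the integrand into a radial function [phi (|w|)] times the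
    twisted integrand. Since [phi s] vanishes unless [s^2 > A > (r + |z|)^2], only radii with
    vanishing means contribute. *)
Lemma moment_of_means z (A r : R) (N : nat) (c : R[i]) : (0 < n)%N -> 0 <= r ->
  (forall s : {posnum R}, r + enorm z < s%:num ->
    \int[sphere_measure n s]_(w in @csphere R n s%:num)
      complex.Re (c * twisted_integrand f z w) = 0) ->
  (r + enorm z) ^+ 2 < A -> (0 < N)%N ->
  moment 0 N z A (fun u => c * gauss_twist f u) = 0.
Proof.
move=> n0 r0 means rA; case: N => // N _.
have A0 : 0 <= A by apply: ltW; apply: le_lt_trans rA; exact: sqr_ge0.
pose F w := complex.Re (c * twisted_integrand f z w).
pose phi (t : R) := truncated_power N.+1 (t ^+ 2 - A) *
  expR (- ((t ^+ 2 - enorm z ^+ 2) / 4)).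
have [B BE] := decay_bounded.
have mphi : measurable_fun setT phi.
  apply: measurable_funM.
    apply: (measurableT_comp (@measurable_truncated_power R _)).
    exact: measurable_funB.
  apply: (measurableT_comp (@measurable_expR R)); apply: measurable_funN.
  by apply: measurable_funM => //; exact: measurable_funB.
have mg : measurable_fun setT (fun u => truncated_power N.+1
    (enorm ((u : 'rV[R[i]]_n) - z) ^+ 2 - A) *
    complex.Re (cexp (herm z u / 2%:R) * (c * gauss_twist f u))).
  apply: measurable_funM; first exact: (measurable_kernel_enorm 0 N.+1 z A).
  apply: (cmeasurableM (cmeasurable_cexp_herm z) _).1.
  exact: cmeasurableM (cmeasurable_cst _ _) rapid_gauss_twist.1.
have gE w : truncated_power N.+1 (enorm ((z - (w : 'rV[R[i]]_n)) - z) ^+ 2 - A) *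
    complex.Re (cexp (herm z (z - (w : 'rV[R[i]]_n)) / 2%:R) *
      (c * gauss_twist f (z - (w : 'rV[R[i]]_n)))) =
    phi (enorm (w : 'rV[R[i]]_n)) * F w.
  rewrite twisted_integrandE subKr /phi /F.
  by rewrite [z - _]addrC addrK enormN.
have mF : measurable_fun setT F.
  have [mf1 mf2] := cmeasurable_continuous.
  have mzw : measurable_fun setT (fun w : borelC R n => z - (w : 'rV[R[i]]_n) : borelC R n).
    apply: measurable_borelCP => j.
    - under eq_fun do rewrite !mxE raddfB /=.
      by apply: measurable_funB => //; exact: measurable_Re_coord.
    - under eq_fun do rewrite !mxE raddfB /=.
      by apply: measurable_funB => //; exact: measurable_Im_coord.
  apply: (cmeasurableM (cmeasurable_cst _ c) _).1; apply: cmeasurableM.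
    by split; [exact: (measurableT_comp mf1 mzw)|exact: (measurableT_comp mf2 mzw)].
  have mIm : measurable_fun setT (fun w : borelC R n =>
      complex.Im (\sum_j z 0 j * ((w : 'rV[R[i]]_n) 0 j)^*) / 2).
    apply: measurable_funM => //.
    rewrite (_ : (fun w => _) = fun w : borelC R n => - complex.Im (herm z w)).
      by apply: measurable_funN; exact: measurable_Im_herm.
    apply/funext => w; rewrite /herm !raddf_sum; apply: eq_bigr => j _.
    by case: (z 0 j) ((w : 'rV__) 0 j) => [a b] [a' b'] /=; ring.
  split; apply: (measurableT_comp _ mIm).
  - exact: continuous_measurable_fun (@continuous_cos R).
  - exact: continuous_measurable_fun (@continuous_sin R).
rewrite -[RHS](@integral_vanishing_means R n F phi (normc c * B))//.
- rewrite /moment -(Rintegral_reflection z mg).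
  by apply: eq_Rintegral => w _; exact: gE.
- move=> w; apply: (le_trans (normc_Re _)); rewrite !normcM normc_expi mulr1.
  by rewrite ler_wpM2l ?normc_ge0.
- by move=> t; rewrite mulr_ge0 ?truncated_power_ge0 ?expR_ge0.
- by rewrite /phi truncated_power_eq0 ?mul0r// expr0n /= sub0r oppr_le0.
- move=> s; rewrite /phi => phis; apply: means.
  rewrite -(@ltr_pXn2r _ 2)// ?nnegrE ?addr_ge0 ?enorm_ge0//.
  apply: (lt_trans rA); rewrite ltNge; apply: contra phis => sA.
  by rewrite truncated_power_eq0 ?mul0r// subr_le0.
Qed.

(** The factors [1] and [- i] extract the real and imaginary parts of the twisted mean; every [c] is
    a real combination of the two. *)
Lemma annihilated_gauss_twist r : (0 < n)%N -> 0 <= r ->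
  (forall z (s : {posnum R}), r + enorm z < s%:num -> twisted_mean f s z = 0) ->
  annihilated r 0 (gauss_twist f).
Proof.
move=> n0 r0 means z A N c rA N0; have rh := rapid_gauss_twist.
have m1 : moment 0 N z A (fun u => 1 * gauss_twist f u) = 0.
  apply: moment_of_means rA N0 => // s zs.
  have := means z s zs; rewrite /twisted_mean /cintegral => /(congr1 (@complex.Re R)) /= Re0.
  rewrite -[RHS]Re0.
  by apply: eq_Rintegral => w _; rewrite mul1r.
have m2 : moment 0 N z A (fun u => (0 -i* 1) * gauss_twist f u) = 0.
  apply: moment_of_means rA N0 => // s zs.
  have := means z s zs; rewrite /twisted_mean /cintegral => /(congr1 (@complex.Im R)) /= Im0.
  rewrite -[RHS]Im0.
  by apply: eq_Rintegral => w _; rewrite ReM /= mul0r sub0r mulN1r opprK.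
rewrite (_ : (fun u => _) = fun u => (complex.Re c)%:C * (1 * gauss_twist f u) +
    (- complex.Im c)%:C * ((0 -i* 1) * gauss_twist f u)); last first.
  apply/funext => u; rewrite !mulrA -mulrDl; congr (_ * _).
  by case: c => a b; apply/eqP; rewrite eq_complex /=; apply/andP; split; apply/eqP; ring.
have r1 := rapidZ 1 rh; have r2 := rapidZ (0 -i* 1) rh.
rewrite momentD; [|exact: (rapidZ _ r1)|exact: (rapidZ _ r2)].
by rewrite (moment_scale _ _ _ _ _ r1) (moment_scale _ _ _ _ _ r2) m1 m2 !mulr0 addr0.
Qed.

End twisted_means.

(** * Polynomial multipliers and localization at a point *)

Section polynomial_multipliers.
Context {R : realType} (n : nat).
Local Open Scope complex_scope.
Local Notation leb := (@lebesgueC R n).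
Implicit Types (z v : 'rV[R[i]]_n) (h : 'rV[R[i]]_n -> R[i]) (u : borelC R n).

(** [b] is existential because it grows with the degree of the multiplier; thus the class is closed
    under multiplication by polynomials in [u] and [conj u]. *)
Definition moments_vanish r h : Prop := rapid h /\ exists b, annihilated r b h.

Lemma annihilated_leq r b k h : rapid h -> annihilated r b h -> annihilated r (k + b) h.
Proof. by move=> rh ah; elim: k => // k IHk; exact: annihilatedS. Qed.

Lemma moments_vanishD r h h' : moments_vanish r h -> moments_vanish r h' ->
  moments_vanish r (fun u => h u + h' u).
Proof.
move=> [rh [b ah]] [rh' [b' ah']]; split; first exact: rapidD.
by exists (b' + b)%N; apply: annihilatedD => //;
  [|rewrite addnC]; exact: annihilated_leq.
Qed.

Lemma moments_vanishZ r (c : R[i]) h : moments_vanish r h ->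
  moments_vanish r (fun u => c * h u).
Proof.
move=> [rh [b ah]]; split; first exact: rapidZ.
by exists b; exact: annihilatedZ.
Qed.

Lemma coordE (u : 'rV[R[i]]_n) j : herm (delta_mx 0 j) u = u 0 j.
Proof.
rewrite /herm (bigD1 j)//= big1 => [|k kj]; rewrite mxE !eqxx ?(negbTE kj) /=.
  by rewrite rmorph1 mul1r addr0.
by rewrite rmorph0 mul0r.
Qed.

Lemma moments_vanish_coord r h j (a : R[i]) : 0 <= r -> moments_vanish r h ->
  moments_vanish r (fun u => (u 0 j - a) * h u) /\
  moments_vanish r (fun u => conjc (u 0 j - a) * h u).
Proof.
move=> r0 vh; have [rh [b ah]] := vh.
have [a1 a2] := annihilated_herm (delta_mx 0 j) r0 rh ah.
split.
- rewrite (_ : (fun u => _) = fun u => herm (delta_mx 0 j) u * h u + (- a) * h u).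
    apply: moments_vanishD; last exact: moments_vanishZ.
    by split; [exact: rapid_herm|exists b.+1].
  by apply/funext => u; rewrite coordE mulrDl.
- rewrite (_ : (fun u => _) =
      fun u => conjc (herm (delta_mx 0 j) u) * h u + (- conjc a) * h u).
    apply: moments_vanishD; last exact: moments_vanishZ.
    by split; [exact: rapid_conj_herm|exists b].
  by apply/funext => u; rewrite coordE rmorphB /= mulrDl.
Qed.

(** A polynomial in [u] and [conj u] with maximum 1 at [u0] for [k > 0]; a small [k] keeps it
    nonnegative on a given bounded set. *)
Definition bump (k : R) (u0 u : 'rV[R[i]]_n) : R := 1 - k * enorm (u - u0) ^+ 2.

Lemma moments_vanish_bump r h k u0 : 0 <= r -> moments_vanish r h ->
  moments_vanish r (fun u => (bump k u0 u)%:C * h u).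
Proof.
move=> r0 vh.
have sums (s : seq 'I_n) : moments_vanish r
    (fun u => (\sum_(j <- s) conjc (u 0 j - u0 0 j) * (u 0 j - u0 0 j)) * h u).
  elim: s => [|j s IHs].
    rewrite (_ : (fun u => _) = fun u => 0 * h u); first exact: moments_vanishZ.
    by apply/funext => u; rewrite big_nil.
  rewrite (_ : (fun u => _) = fun u => conjc (u 0 j - u0 0 j) * ((u 0 j - u0 0 j) * h u) +
      (\sum_(j <- s) conjc (u 0 j - u0 0 j) * (u 0 j - u0 0 j)) * h u).
    apply: moments_vanishD => //; apply: (moments_vanish_coord _ _ r0 _).2.
    exact: (moments_vanish_coord _ _ r0 vh).1.
  by apply/funext => u; rewrite big_cons mulrDl mulrA.
rewrite (_ : (fun u => _) = fun u => h u + (- k%:C) *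
    ((\sum_(j < n) conjc (u 0 j - u0 0 j) * (u 0 j - u0 0 j)) * h u)).
  by apply: moments_vanishD => //; exact: moments_vanishZ.
apply/funext => u; rewrite mulrA -{2}[h u]mul1r -mulrDl; congr (_ * _).
have -> : \sum_(j < n) conjc (u 0 j - u0 0 j) * (u 0 j - u0 0 j) =
    (enorm (u - u0) ^+ 2)%:C.
  rewrite enorm_sqr rmorph_sum; apply: eq_bigr => j _; rewrite !mxE.
  case: (u 0 j) (u0 0 j) => [a b] [a' b']; apply/eqP; rewrite eq_complex /=.
  by apply/andP; split; apply/eqP; ring.
by rewrite /bump rmorphB rmorph1 rmorphM /= mulNr.
Qed.

Lemma moments_vanish_bumpX r h k u0 m : 0 <= r -> moments_vanish r h ->
  moments_vanish r (fun u => (bump k u0 u ^+ m)%:C * h u).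
Proof.
move=> r0 vh; elim: m => [|m IHm].
  by rewrite (_ : (fun u => _) = h)//; apply/funext => u; rewrite expr0 mul1r.
rewrite (_ : (fun u => _) = fun u => (bump k u0 u)%:C * ((bump k u0 u ^+ m)%:C * h u)).
  exact: moments_vanish_bump.
by apply/funext => u; rewrite exprS rmorphM mulrA.
Qed.

(** A tent on [[A, A + 2 e]] for [e > 0], with peak value [e / 2] at [A + e]. *)
Definition hat (A e x : R) : R := truncated_power 1 (x - A) -
  2 * truncated_power 1 (x - (A + e)) + truncated_power 1 (x - (A + 2 * e)).

Lemma truncated_power1 (x : R) : truncated_power 1 x = Num.max x 0 / 2.
Proof. by rewrite /truncated_power expr1 divr1. Qed.

Lemma hat_eq0 A e x : 0 <= e -> A + 2 * e < x -> hat A e x = 0.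
Proof.
move=> e0 xA; rewrite /hat !truncated_power1.
by case: (leP (x - A) 0) => ?; case: (leP (x - (A + e)) 0) => ?;
  case: (leP (x - (A + 2 * e)) 0) => ?; lra.
Qed.

Lemma hat_gt0 A e : 0 < e -> 0 < hat A e (A + e).
Proof.
move=> e0; rewrite /hat !truncated_power1.
by case: (leP (A + e - A) 0) => ?; case: (leP (A + e - (A + e)) 0) => ?;
  case: (leP (A + e - (A + 2 * e)) 0) => ?; lra.
Qed.

Lemma continuous_hat A e : continuous (hat A e).
Proof.
have cT : continuous (truncated_power 1 : R -> R).
  rewrite (_ : truncated_power 1 = fun x : R => Num.max x 0 / 2); last first.
    by apply/funext => x; rewrite truncated_power1.
  move=> x; apply: cvgM; last exact: cvg_cst.
  by apply: continuous_max; [exact: cvg_id|exact: cvg_cst].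
have cTa (a : R) : continuous (fun x : R => truncated_power 1 (x - a)).
  move=> x; apply: (@continuous_comp _ _ _ (fun x : R => x - a)); last exact: cT.
  by apply: cvgB; [exact: cvg_id|exact: cvg_cst].
move=> x; apply: cvgD; last exact: cTa.
by apply: cvgB; [exact: cTa|apply: cvgM; [exact: cvg_cst|exact: cTa]].
Qed.

Lemma hatE A e h u : hat A e (enorm (u : 'rV[R[i]]_n) ^+ 2) * complex.Re (h u) =
  kernel 0 1 (enorm ((u : 'rV[R[i]]_n) - 0) ^+ 2 - A) *
    complex.Re (cexp (herm 0 u / 2%:R) * h u) -
  2 * (kernel 0 1 (enorm ((u : 'rV[R[i]]_n) - 0) ^+ 2 - (A + e)) *
    complex.Re (cexp (herm 0 u / 2%:R) * h u)) +
  kernel 0 1 (enorm ((u : 'rV[R[i]]_n) - 0) ^+ 2 - (A + 2 * e)) *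
    complex.Re (cexp (herm 0 u / 2%:R) * h u).
Proof. by rewrite subr0 cexp_herm0 mul1r /hat /kernel; ring. Qed.

Lemma hat_integrable A e h : rapid h -> leb.-integrable setT
  (EFin \o (fun u => hat A e (enorm (u : 'rV[R[i]]_n) ^+ 2) * complex.Re (h u))).
Proof.
move=> rh; have mint B := moment_integrable 0 1 0 B rh.
have i2 := integrableZl measurableT 2 (mint (A + e)).
have := integrableD measurableT (integrableB measurableT (mint A) i2) (mint (A + 2 * e)).
by apply: eq_integrable => // u _; rewrite /= hatE.
Qed.

Lemma hat_integral0 r h A e : moments_vanish r h -> r ^+ 2 < A -> 0 <= e ->
  \int[leb]_u (hat A e (enorm (u : 'rV[R[i]]_n) ^+ 2) * complex.Re (h u)) = 0.
Proof.
move=> [rh [b ah]] rA e0; have mint B := moment_integrable 0 1 0 B rh.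
have i2 := integrableZl measurableT 2 (mint (A + e)).
have i12 := integrableB measurableT (mint A) i2.
have m0 B : A <= B -> moment 0 1 0 B h = 0.
  by move=> AB; apply: (annihilated_moment0 rh ah) => //; exact: lt_le_trans AB.
under eq_Rintegral do rewrite hatE.
rewrite (RintegralD measurableT i12 (mint _)) (RintegralB measurableT (mint _) i2).
rewrite (RintegralZl _ measurableT (mint _)) -!/(moment _ _ _ _ _).
by rewrite !m0 ?mulr0 ?subr0 ?addr0//; lra.
Qed.

Definition eball (u0 : 'rV[R[i]]_n) (d : R) : set (borelC R n) :=
  [set u | enorm ((u : 'rV[R[i]]_n) - u0) <= d].

Lemma indic_ball_integrable (u0 : 'rV[R[i]]_n) (d : R) :
  leb.-integrable setT (EFin \o (\1_(eball u0 d) : borelC R n -> R)).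
Proof.
set B := eball u0 d; have mB : measurable B.
  rewrite (_ : B = [set u : borelC R n | 0 <= d /\
      enorm ((u : 'rV[R[i]]_n) - u0) ^+ 2 <= d ^+ 2]).
    have [d0|d0] := leP 0 d; last first.
      rewrite (_ : mkset _ = set0)//; by apply/seteqP; split=> u //= [].
    rewrite (_ : mkset _ = (fun u : borelC R n =>
        enorm ((u : 'rV[R[i]]_n) - u0) ^+ 2) @^-1` `]-oo, d ^+ 2]%classic).
      by rewrite -[X in measurable X]setTI; exact: measurable_enormB.
    by apply/seteqP; split=> u /=; rewrite in_itv /=; [case|].
  apply/seteqP; split=> u; rewrite /B /eball /=.
    move=> ud; have d0 := le_trans (enorm_ge0 _) ud.
    by split=> //; rewrite lerXn2r// nnegrE ?enorm_ge0.
  by move=> [d0]; rewrite ler_pXn2r// nnegrE ?enorm_ge0.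
(* An upper bound for [weight] on the ball, from [|u|^2 <= 2 |u - u0|^2 + 2 |u0|^2]; the
   nonnegativity of [|u - 2 u0|^2] below proves the latter. *)
pose M := 1 + 2 * enorm u0 ^+ 2 + 2 * d ^+ 2.
have M0 : 0 <= M.
  by rewrite /M; have := sqr_ge0 (enorm u0); have := sqr_ge0 d; lra.
apply: (integrable_weight_bound (C := M ^+ (n + n))) => [|u]; first exact: measurable_indic.
have w0 := weight_gt0 u; rewrite indicE; case: (boolP (u \in B)); last first.
  by rewrite normr0 mulr_ge0// exprn_ge0// ?invr_ge0 ?ltW.
rewrite inE /B /eball /= normr1 => ud; rewrite -exprMn exprn_ege1// ler_pdivlMr// mul1r.
have d0 := le_trans (enorm_ge0 _) ud.
have : enorm ((u : 'rV[R[i]]_n) - u0) ^+ 2 <= d ^+ 2.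
  by rewrite lerXn2r// nnegrE ?enorm_ge0.
have := sqr_ge0 (enorm ((u : 'rV[R[i]]_n) - 2%:C *: u0)).
rewrite enormBZ_sqr enormB_sqr /weight /M.
by move: (complex.Re _) (enorm _ ^+ 2) (enorm u0 ^+ 2) (d ^+ 2) => a p q e h1 h2; lra.
Qed.

(** The punctured ball at 0 is [sector s setT], of positive volume because the surface measure is
    positive; translation brings it to [u0]. *)
Lemma indic_ball_gt0 (u0 : 'rV[R[i]]_n) (d : R) : (0 < n)%N -> 0 < d ->
  0 < \int[leb]_u (\1_(eball u0 d) u : R).
Proof.
move=> n0 d0; set B := eball u0 d; have iB := indic_ball_integrable u0 d.
have mB : measurable_fun setT (EFin \o (\1_B : borelC R n -> R)) by case/integrableP: iB.
rewrite /Rintegral fine_gt0//; apply/andP; split; last first.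
  rewrite -ge0_fin_numE; first exact: integrable_fin_num.
  by apply: integral_ge0 => x _; rewrite lee_fin.
have := ge0_integral_lebesgueC_affine u0 (oner_neq0 R) mB (fun x => _).
rewrite normr1 invr1 expr1n mul1e => <-; last by move=> x; rewrite lee_fin.
pose s := PosNum d0.
have := @surface_measure_setT_gt0 R n s n0; rewrite /surface_measure => surf.
have sect : (0 < leb (sector s setT))%E.
  rewrite lt_neqAle measure_ge0 andbT eq_sym; apply: contraTneq surf => ->.
  by rewrite mule0 ltxx.
apply: (lt_le_trans sect).
have ms : measurable (sector s setT : set (borelC R n)) by exact: measurable_sector.
rewrite -(setIT (sector s setT)) -(integral_indic leb measurableT ms).
apply: ge0_le_integral => //.
- exact/measurable_EFinP/measurable_indic.
- apply: (measurableT_comp mB); apply: measurable_borelCP => j.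
    rewrite (_ : (fun x => _) = fun x : borelC R n =>
        complex.Re ((x : 'rV_n) 0 j) + complex.Re (u0 0 j)).
      by apply: measurable_funD => //; exact: measurable_Re_coord.
    by apply/funext => x; rewrite rmorph1 scale1r mxE raddfD.
  rewrite (_ : (fun x => _) = fun x : borelC R n =>
      complex.Im ((x : 'rV_n) 0 j) + complex.Im (u0 0 j)).
    by apply: measurable_funD => //; exact: measurable_Im_coord.
  by apply/funext => x; rewrite rmorph1 scale1r mxE raddfD.
- move=> x _; rewrite lee_fin !indicE; case: (boolP (x \in _)) => // xs.
  rewrite (_ : _ \in B) ?lexx// inE /B /eball /=; move: xs; rewrite inE => -[/= xs _].
  by rewrite rmorph1 scale1r addrK; case/andP: xs.
Qed.

(* The powers [bump ^+ m] dominate [t' ^+ m] on the ball of radius [d / 2] and are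
   at most [t ^+ m] on the shell outside the ball of radius [d], with [t < t']. *)
Lemma moments_vanish_eq0 r h (u0 : 'rV[R[i]]_n) : (0 < n)%N -> 0 <= r ->
  moments_vanish r h -> continuous h -> r < enorm u0 -> h u0 = 0.
Proof.
move=> n0 r0 vh ch ru0; apply/eqP; apply: contraT => hu0.
have rr : r ^+ 2 < enorm u0 ^+ 2 by rewrite ltr_pXn2r// nnegrE ?enorm_ge0.
(* [A] is the midpoint of [r^2] and [|u0|^2], and the tent peaks at [A + e = |u0|^2]. *)
pose e := (enorm u0 ^+ 2 - r ^+ 2) / 2; pose A := enorm u0 ^+ 2 - e.
have e0 : 0 < e by rewrite /e; lra.
have rA : r ^+ 2 < A by rewrite /A /e; lra.
(* With this [c], [Re (c * h u0) = |h u0|^2 > 0]. *)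
pose c := conjc (h u0).
pose g u := hat A e (enorm (u : 'rV[R[i]]_n) ^+ 2) * complex.Re (c * h u).
have vch := moments_vanishZ c vh.
have ig : leb.-integrable setT (EFin \o g) by exact: hat_integrable vch.1.
have gu0 : 0 < g u0.
  rewrite mulr_gt0//; first by rewrite -[X in hat _ _ X](subrK e) -/A hat_gt0.
  rewrite /c; case: (h u0) hu0 => a b; rewrite eq_complex /= negb_and => ab.
  rewrite mulNr opprK -!expr2; have := sqr_ge0 a; have := sqr_ge0 b.
  by case/orP: ab; rewrite -sqrf_eq0 => /eqP; lra.
have cg : (g : 'rV[R[i]]_n -> R) u @[u --> u0] --> g u0.
  apply: (@cvgM _ _ (nbhs u0) _ (fun u : 'rV[R[i]]_n => hat A e (enorm u ^+ 2))).
    apply: (@continuous_comp _ _ _ (fun u : 'rV[R[i]]_n => enorm u ^+ 2)).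
      by apply: (@cvgM _ _ (nbhs u0) _ (@enorm R n)); exact: continuous_enorm.
    exact: continuous_hat.
  apply: (@continuous_comp _ _ _ (fun u : 'rV[R[i]]_n => c * h u) (@complex.Re R));
    last exact: continuous_Re.
  by apply: (@cvgM _ _ (nbhs u0) _ (fun=> c)); [exact: cvg_cst|exact: ch].
have [d d0 dg] : exists2 d : R, 0 < d &
    forall u : 'rV[R[i]]_n, enorm (u - u0) <= d -> g u0 / 2 <= g u.
  have : \forall u \near u0, g u0 / 2 < (g : 'rV[R[i]]_n -> R) u.
    by apply: (cvgr_gt _ cg); lra.
  move=> /nbhs_ballP[x /= x0 xg].
  have [y xE] : exists y, x = y%:C.
    by exists (complex.Re x); rewrite RRe_real// gtr0_real.
  (* The neighbourhood is a sup-norm ball of radius [y]; coordinates are bounded by [enorm], and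
     halving [y] turns [<=] into the strict inequality required. *)
  move: x0 xg; rewrite xE ltcR => y0 yg; exists (y / 2); first by rewrite divr_gt0.
  move=> u uy; apply: ltW; apply: yg; split; first by rewrite ltcR.
  move=> i j; rewrite !ord1 {i} /ball /= -[X in X < _]/((normc (u0 0 j - u 0 j))%:C) ltcR.
  apply: (@le_lt_trans _ _ (y / 2)); last by lra.
  apply: le_trans uy; rewrite -[leLHS]ger0_norm ?normc_ge0// -sqrtr_sqr ler_wsqrtr//.
  rewrite (bigD1 j)//= !mxE -opprB normcN lerDl.
  by apply: sumr_ge0 => k _; rewrite sqr_ge0.
(* Where [hat] is nonzero, [|u|^2 <= A + 2 e], so [|u - u0|^2 <= M] and the bump is nonnegative. The
   term [2 d^2] makes [t] positive. *)
pose M := 2 * (A + 2 * e) + 2 * enorm u0 ^+ 2 + 2 * d ^+ 2 + 1.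
have A0 : 0 <= A by apply: ltW; apply: le_lt_trans rA; exact: sqr_ge0.
have M0 : 0 < M.
  by rewrite /M; have := sqr_ge0 (enorm u0); have := sqr_ge0 d; lra.
pose k := M^-1; have k0 : 0 < k by rewrite invr_gt0.
have kM : k * M = 1 by rewrite mulVf ?gt_eqF.
(* The values of the bump at distances [d] and [d / 2] from [u0]. *)
pose t := 1 - k * d ^+ 2; pose t' := 1 - k * (d / 2) ^+ 2.
have kd : 0 < k * d ^+ 2 by rewrite mulr_gt0// exprn_gt0.
have kd2 : k * (d / 2) ^+ 2 = k * d ^+ 2 / 4 by rewrite expr_div_n; field.
have t0 : 0 < t.
  have : k * (2 * d ^+ 2) < k * M.
    by rewrite ltr_pM2l// /M; have := sqr_ge0 (enorm u0); lra.
  by rewrite kM /t; lra.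
have tt' : t < t' by rewrite /t /t' kd2; lra.
pose V := \int[leb]_u (\1_(eball u0 (d / 2)) u : R).
have V0 : 0 < V by apply: indic_ball_gt0 => //; rewrite divr_gt0.
have iV := indic_ball_integrable u0 (d / 2).
have ing : leb.-integrable setT (EFin \o (fun u => `|g u|)).
  by have := integrable_abse ig; apply: eq_integrable.
pose I := \int[leb]_u `|g u|.
(* Pointwise, [bump^m g] is at least [t'^m (g u0 / 2)] times the indicator of the small ball, minus
   [t^m |g|]; its integral is 0. *)
have key m : t' ^+ m * (g u0 / 2) * V <= t ^+ m * I.
  have ib : leb.-integrable setT (EFin \o (fun u => bump k u0 u ^+ m * g u)).
    have := hat_integrable A e (moments_vanish_bumpX k u0 m r0 vch).1.
    by apply: eq_integrable => // u _; rewrite /= Re_real mulrCA.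
  have b0 : \int[leb]_u (bump k u0 u ^+ m * g u) = 0.
    rewrite -[RHS](hat_integral0 (moments_vanish_bumpX k u0 m r0 vch) rA (ltW e0)).
    by apply: eq_Rintegral => u _; rewrite Re_real mulrCA.
  have i1 := integrableZl measurableT (t' ^+ m * (g u0 / 2)) iV.
  have i2 := integrableZl measurableT (t ^+ m) ing.
  rewrite -subr_le0 -b0 -(RintegralZl _ measurableT iV) -(RintegralZl _ measurableT ing).
  rewrite -(RintegralB measurableT i1 i2).
  apply: le_Rintegral => //; first exact: (integrableB measurableT i1 i2).
  move=> u _; rewrite indicE.
  have tm : 0 <= t ^+ m by rewrite exprn_ge0// ltW.
  have [ud|ud] := leP (enorm ((u : 'rV[R[i]]_n) - u0)) d.
    have gu := dg u ud; have g0 : 0 <= g u by rewrite (le_trans _ gu)// divr_ge0// ltW.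
    have bt : t <= bump k u0 u.
      by rewrite /t /bump lerB// ler_pM2l// lerXn2r// nnegrE ?enorm_ge0 ?ltW.
    have bm : 0 <= bump k u0 u ^+ m by rewrite exprn_ge0// (le_trans _ bt)// ltW.
    apply: (@le_trans _ _ (t' ^+ m * (g u0 / 2) * (u \in eball u0 (d / 2))%:R)).
      by rewrite gerBl mulr_ge0.
    case: (boolP (u \in _)) => [|_]; last by rewrite mulr0 mulr_ge0.
    rewrite inE /eball /= => ud2; rewrite mulr1; have t'0 := lt_trans t0 tt'.
    apply: ler_pM => //; first exact: exprn_ge0 (ltW t'0).
      by rewrite divr_ge0 ?ltW.
    rewrite lerXn2r// ?nnegrE.
    - exact: ltW.
    - by rewrite (le_trans _ bt)// ltW.
    - by rewrite /t' /bump lerB// ler_pM2l// lerXn2r// nnegrE ?enorm_ge0 ?divr_ge0 ?ltW.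
  (* Outside the ball of radius [d], either [g u = 0] or [0 <= bump <= t]. *)
  have -> : (u \in eball u0 (d / 2)) = false.
    by apply/negP; rewrite inE /eball /= => ud2; move: ud d0 ud2; clear; lra.
  rewrite mulr0 sub0r; have [gz|gz] := eqVneq (g u) 0; first by rewrite gz normr0 !mulr0 oppr0.
  have uA : enorm (u : 'rV[R[i]]_n) ^+ 2 <= A + 2 * e.
    rewrite leNgt; apply: contra gz => uA; rewrite /g hat_eq0 ?mul0r//; exact: ltW.
  have bump0 : 0 <= bump k u0 u.
    rewrite /bump subr_ge0 -kM ler_pM2l// /M.
    have := Re_herm_le u0 u; rewrite enormB_sqr ler_norml => /andP[].
    by have := sqr_ge0 d; move: uA; clear; lra.
  have bumpt : bump k u0 u <= t.
    by rewrite /t /bump lerB// ler_pM2l// lerXn2r// ?nnegrE ?enorm_ge0 ?(ltW d0) ?(ltW ud).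
  have bmt : bump k u0 u ^+ m <= t ^+ m by rewrite lerXn2r// nnegrE// ltW.
  have bm0 : 0 <= bump k u0 u ^+ m by rewrite exprn_ge0.
  apply: (@le_trans _ _ (- (bump k u0 u ^+ m * `|g u|))).
    by rewrite lerN2 ler_wpM2r.
  by rewrite lerNl -mulrN ler_wpM2l// -normrN ler_norm.
have q1 : `|t / t'| < 1.
  have t'0 := lt_trans t0 tt'.
  by rewrite gtr0_norm ?divr_gt0// ltr_pdivrMr// mul1r.
(* Divided by [t'^m], the right side of [key] tends to 0 while the left side stays at a positive
   value. *)
have lim : (t / t') ^+ m * I @[m --> \oo] --> 0 * I.
  by apply: cvgM; [exact: cvg_expr|exact: cvg_cst].
have : g u0 / 2 * V <= 0 * I.
  apply: (ler_cvg_to (cvg_cst _) lim); apply: nearW => m.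
  have t'm : 0 < t' ^+ m by rewrite exprn_gt0// (lt_trans t0).
  by rewrite expr_div_n [leRHS]mulrAC ler_pdivlMr// mulrC mulrA key.
by rewrite mul0r leNgt mulr_gt0// divr_gt0.
Qed.

End polynomial_multipliers.

(** * Supports, the triangle inequality, and the theorem *)

Section support.
Context {R : realType} (n : nat).
Local Open Scope complex_scope.
Implicit Types (z u : 'rV[R[i]]_n).

(** Cauchy-Schwarz from the nonnegative quadratic [|u - t z|^2] in the real variable [t]. *)
Lemma Re_herm_sqr_le z u :
  complex.Re (herm z u) ^+ 2 <= enorm z ^+ 2 * enorm u ^+ 2.
Proof.
have q t : 0 <= enorm u ^+ 2 - t * (2 * complex.Re (herm z u)) + t ^+ 2 * enorm z ^+ 2.
  by rewrite -enormBZ_sqr sqr_ge0.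
move: (complex.Re _) (enorm u ^+ 2) (enorm z ^+ 2) (sqr_ge0 (enorm z)) q => a p e e0 q.
have [ez|ez] := eqVneq e 0.
  have [->|a0] := eqVneq a 0; first by rewrite ez mul0r expr0n.
  (* With [z = 0] the quadratic degenerates to [p - 2 a t], which would be -1 at this [t]. *)
  have := q ((p + 1) / (2 * a)); rewrite ez mulr0 addr0 divfK ?mulf_neq0 ?pnatr_eq0//.
  by lra.
have ep : 0 < e by rewrite lt_def ez.
(* [a / e] minimizes the quadratic. *)
have := mulr_ge0 e0 (q (a / e)).
have -> : e * (p - a / e * (2 * a) + (a / e) ^+ 2 * e) = e * p - a ^+ 2 by field.
by rewrite subr_ge0.
Qed.

Lemma enorm_triangle z u : enorm (z + u) <= enorm z + enorm u.
Proof.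
rewrite -(@ler_pXn2r _ 2)// ?nnegrE ?addr_ge0 ?enorm_ge0//.
have -> : enorm (z + u) ^+ 2 =
    enorm z ^+ 2 + enorm u ^+ 2 + 2 * complex.Re (herm u z).
  by rewrite -{1}(opprK u) enormB_sqr enormN hermNl raddfN /=; ring.
rewrite sqrrD -[enorm z * enorm u *+ 2]mulr_natl.
suff : complex.Re (herm u z) <= enorm z * enorm u by lra.
apply: (le_trans (ler_norm _)); rewrite -(@ler_pXn2r _ 2)// ?nnegrE ?mulr_ge0 ?enorm_ge0//.
by rewrite real_normK ?num_real// exprMn mulrC Re_herm_sqr_le.
Qed.

Variable f : 'rV[R[i]]_n -> R[i].

Lemma twisted_mean_eq0 (s : {posnum R}) z :
  (forall w, enorm w = s%:num -> f (z - w) = 0) -> twisted_mean f s z = 0.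
Proof.
move=> f0; rewrite /twisted_mean /cintegral; congr (_ +i* _);
  by rewrite /Rintegral integral0_eq// => w /f0 ->; rewrite mul0r.
Qed.

(** The Euclidean ball is closed, so it absorbs the closure in [supp]. *)
Lemma supp_sub_ballP (r : R) :
  supp f `<=` [set z | enorm z <= r] <-> (forall z, r < enorm z -> f z = 0).
Proof.
split=> [fr z rz|f0].
  apply/eqP; apply: contraT => fz; suff : enorm z <= r by rewrite leNgt rz.
  by apply: fr; exact: subset_closure.
have cl : closed [set z : 'rV[R[i]]_n | enorm z <= r].
  have := @closed_comp _ _ (@enorm R n) [set x | x <= r] (fun z _ => @continuous_enorm R n z).
  by apply; exact: closed_le.
rewrite [X in _ `<=` X]((closure_id _).1 cl).
by apply: closure_subset => z /=; apply: contraNT; rewrite -ltNge => /f0 ->.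
Qed.

Lemma continuous_gauss_twist : continuous f -> continuous (gauss_twist f).
Proof.
move=> cf u.
have E : (expR (- (enorm y ^+ 2 / 4)))%:C @[y --> u] --> (expR (- (enorm u ^+ 2 / 4)))%:C.
  apply: (@continuous_comp _ _ _ (fun y : 'rV[R[i]]_n => expR (- (enorm y ^+ 2 / 4)))
    (fun x : R => x%:C)); last exact: continuous_real_complex.
  apply: (@continuous_comp _ _ _ (fun y : 'rV[R[i]]_n => - (enorm y ^+ 2 / 4)));
    last exact: continuous_expR.
  apply: (@cvgN _ _ _ (nbhs u)).
  apply: (@cvgM _ _ (nbhs u) _ (fun y : 'rV[R[i]]_n => enorm y ^+ 2) (fun=> 4^-1)).
    by apply: (@cvgM _ _ (nbhs u) _ (@enorm R n)); exact: continuous_enorm.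
  exact: cvg_cst.
exact: (@cvgM _ _ (nbhs u) _ _ _ _ _ E (cf u)).
Qed.

End support.

Theorem theorem1p2 (R : realType) (n : nat) (hn : (1 <= n)%N)
    (r : R) (hr : 0 <= r) (f : 'rV[R[i]]_n -> R[i]) (hf : continuous f)
    (hdecay : forall k : nat, exists C : R, forall z : 'rV[R[i]]_n,
      enorm z ^+ k * expR (4^-1 * enorm z ^+ 2) * normc (f z) <= C) :
  supp f `<=` [set z | enorm z <= r] <->
  (forall (z : 'rV[R[i]]_n) (s : {posnum R}),
    r + enorm z < s%:num -> twisted_mean f s z = 0).
Proof.
rewrite supp_sub_ballP; split=> [f0 z s rs|means u ru].
  apply: twisted_mean_eq0 => w ws; apply: f0.
  (* For [|w| = s] this gives [|z - w| >= s - |z| > r]. *)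
  have := enorm_triangle (- (z - w)) z; rewrite enormN opprB subrK ws.
  by move=> /(lt_le_trans rs); rewrite ltrD2r.
have mv : moments_vanish r (gauss_twist f).
  split; first exact: rapid_gauss_twist hf hdecay.
  by exists 0%N; exact: annihilated_gauss_twist means.
have := moments_vanish_eq0 hn hr mv (continuous_gauss_twist hf) ru.
move=> /eqP; rewrite /gauss_twist mulf_eq0 => /orP[|/eqP//].
by rewrite eq_complex /= eqxx andbT gt_eqF ?expR_gt0.
Qed.
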